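(* If $P$ is an even simple $d$-polytope with $n$ facets, $d\ge 1$, then $s(P)=n-d$.
   Context: Polytopes are convex. A $d$-polytope is simple if each vertex lies in exactly $d$ facets; a simple polytope is even if each of its $2$-faces has an even number of vertices (a $2$-polytope is regarded as a $2$-face of itself). Let $P$ be a simple $d$-polytope with facets $\mathcal{F}=(F_1,\ldots,F_n)$ and let $T=(\mathbb{C}\setminus\{0\})^{\mathcal{F}}$ be the $n$-dimensional complex algebraic torus. On $P\times T$ define $(p,s)\sim(q,t)$ iff $p=q$ and the $i$-th component of $st^{-1}\in T$ is trivial for all facets $F_i$ not containing the point $p=q$. Put $\mathcal{Z}_P=(P\times T)/\!\sim$, on which $T$ acts by multiplication on the second factor. The action is free over the interior of $P$, and points over the relative interior of a $k$-dimensional face have a $(d-k)$-dimensional isotropy group. The number $s(P)$ is the maximal dimension of a subgroup of the algebraic torus $T$ which acts freely on $\mathcal{Z}_P$ (subgroups being algebraic subgroups, with dimension in the sense of complex algebraic groups, so that $\dim T=n$). *)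

(* Defs.v *)
From HB Require Import structures.
From mathcomp Require Import all_boot all_order all_algebra.
From mathcomp Require Import boolp classical_sets functions cardinality reals.
From mathcomp Require Import complex mpoly.

Set Implicit Arguments.
Unset Strict Implicit.
Unset Printing Implicit Defensive.

Import Order.TTheory GRing.Theory Num.Theory.

Local Open Scope classical_set_scope.
Local Open Scope card_scope.
Local Open Scope quotient_scope.
Local Open Scope ring_scope.

(** * Polytopes in R^m *)

Section Polytopes.
Context {R : realType} {m : nat}.
Implicit Types (A P : set 'rV[R]_m) (d : nat).

Definition aff_hull A : set 'rV[R]_m :=
  [set x | exists k (p : 'I_k -> 'rV[R]_m) (c : 'I_k -> R),
     [/\ forall i, A (p i), \sum_i c i = 1 & x = \sum_i c i *: p i]].

Definition conv_hull A : set 'rV[R]_m :=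
  [set x | exists k (p : 'I_k -> 'rV[R]_m) (c : 'I_k -> R),
     [/\ forall i, A (p i), forall i, 0 <= c i, \sum_i c i = 1
       & x = \sum_i c i *: p i]].

Definition polytope P : Prop :=
  exists2 X, finite_set X & P = conv_hull X.

(* The empty set has no dimension in this sense. *)
Definition has_dim A d : Prop :=
  exists (x0 : 'rV[R]_m) (U : {vspace 'rV[R]_m}),
    \dim U = d /\ aff_hull A = [set x | x - x0 \in U].

(* Taking a = 0, both P itself and the empty set are faces of P. *)
Definition face P A : Prop :=
  exists (a : 'cV[R]_m) (b : R),
    (forall x, P x -> (x *m a) 0 0 <= b) /\
    A = [set x | P x /\ (x *m a) 0 0 = b].

Definition vertices P : set 'rV[R]_m := [set v | face P [set v]].

Definition facet P A : Prop :=
  face P A /\ exists e, has_dim P e.+1 /\ has_dim A e.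

Definition simple_polytope d P : Prop :=
  [/\ polytope P, has_dim P d &
      forall v, vertices P v -> [set A | facet P A /\ A v] #= `I_d].

Definition even_polytope P : Prop :=
  forall A, face P A -> has_dim A 2 -> exists k, vertices A #= `I_(k.*2).

End Polytopes.

(** * The algebraic torus (C \ {0})^n *)

Section Torus.
Context {R : realType} {n : nat}.

Record torus := Torus {
  tval :> {ffun 'I_n -> R[i]};
  _ : [forall i, tval i != 0] }.

HB.instance Definition _ := [isSub for tval].
HB.instance Definition _ := [Choice of torus by <:].

Implicit Types s t u : torus.

Lemma torus_neq0 t i : t i != 0.
Proof. by case: t => f /= /forallP. Qed.

Lemma torus_one_subproof : [forall i : 'I_n, [ffun=> 1] i != 0 :> R[i]].
Proof. by apply/forallP => i; rewrite ffunE oner_neq0. Qed.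

Lemma torus_mul_subproof s t : [forall i : 'I_n, [ffun j => s j * t j] i != 0].
Proof. by apply/forallP => i; rewrite ffunE mulf_neq0 ?torus_neq0. Qed.

Lemma torus_inv_subproof t : [forall i : 'I_n, [ffun j => (t j)^-1] i != 0].
Proof. by apply/forallP => i; rewrite ffunE invr_neq0 ?torus_neq0. Qed.

Definition torus_one : torus := Torus torus_one_subproof.
Definition torus_mul s t : torus := Torus (torus_mul_subproof s t).
Definition torus_inv t : torus := Torus (torus_inv_subproof t).

Lemma torusP s t : (forall i, s i = t i) -> s = t.
Proof. by move=> st; apply/val_inj/ffunP. Qed.

Lemma torus_mulA : associative torus_mul.
Proof. by move=> s t u; apply: torusP => i; rewrite !ffunE mulrA. Qed.

Lemma torus_mul1 : left_id torus_one torus_mul.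
Proof. by move=> t; apply: torusP => i; rewrite !ffunE mul1r. Qed.

Lemma torus_mulr1 : right_id torus_one torus_mul.
Proof. by move=> t; apply: torusP => i; rewrite !ffunE mulr1. Qed.

Lemma torus_mulV : left_inverse torus_one torus_inv torus_mul.
Proof.
by move=> t; apply: torusP => i; rewrite !ffunE mulVf ?torus_neq0.
Qed.

Lemma torus_mulrV : right_inverse torus_one torus_inv torus_mul.
Proof.
by move=> t; apply: torusP => i; rewrite !ffunE mulfV ?torus_neq0.
Qed.

HB.instance Definition _ := isGroup.Build torus
  torus_mulA torus_mul1 torus_mulr1 torus_mulV torus_mulrV.

Lemma torus1E i : (1%g : torus) i = 1.
Proof. by rewrite ffunE. Qed.

Lemma torusME s t i : (s * t)%g i = s i * t i.
Proof. by rewrite ffunE. Qed.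

Lemma torusVE t i : (t^-1)%g i = (t i)^-1.
Proof. by rewrite ffunE. Qed.

(* Clearing denominators, Laurent polynomials have the same zero sets. *)
Definition zariski_closed (Z : set torus) : Prop :=
  exists I : set {mpoly R[i][n]},
    Z = [set t : torus | forall p, I p -> p.@[t] = 0].

Definition irreducible_closed (Z : set torus) : Prop :=
  [/\ zariski_closed Z, Z !=set0 &
      forall A B, zariski_closed A -> zariski_closed B ->
        Z = A `|` B -> Z = A \/ Z = B].

Definition irreducible_chain (Z : set torus) (k : nat) : Prop :=
  exists Y : nat -> set torus,
    (forall i, (i <= k)%N -> irreducible_closed (Y i) /\ Y i `<=` Z) /\
    (forall i, (i < k)%N -> Y i `<` Y i.+1).

(* Dimension of a closed subvariety: the Krull dimension. *)
Definition krull_dim (Z : set torus) (k : nat) : Prop :=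
  irreducible_chain Z k /\
  forall l, irreducible_chain Z l -> (l <= k)%N.

Definition algebraic_subgroup (G : set torus) : Prop :=
  zariski_closed G /\ group_closed (mem G).

End Torus.

Arguments torus : clear implicits.

(** * The T-space Z_P and the number s(P) *)

Section MomentAngle.
Context {R : realType} {m n : nat}.
Variables (P : set 'rV[R]_m) (F : 'I_n -> set 'rV[R]_m).

Definition zrel (x y : P * torus R n) : bool :=
  (x.1 == y.1) &&
  [forall i, (val x.1 \notin F i) ==> ((x.2 * y.2^-1)%g i == 1)].

Lemma zrelP (x y : P * torus R n) :
  reflect (x.1 = y.1 /\ forall i, ~ F i (val x.1) -> x.2 i = y.2 i) (zrel x y).
Proof.
apply: (iffP andP) => -[].
  move=> /eqP xy /forallP xyF; split=> // i /asboolPn Fx.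
  have /implyP/(_ Fx)/eqP := xyF i; rewrite torusME torusVE => /divr1_eq.
  exact.
move=> -> xyF; split=> //; apply/forallP => i; apply/implyP => /asboolPn Fx.
by rewrite torusME torusVE xyF // divff ?torus_neq0.
Qed.

Lemma zrel_refl : reflexive zrel.
Proof. by move=> x; apply/zrelP. Qed.

Lemma zrel_sym : ssrbool.symmetric zrel.
Proof.
by move=> x y; apply/zrelP/zrelP => -[e h]; split=> // i;
  rewrite -?e => Fi; rewrite h ?e // -e.
Qed.

Lemma zrel_trans : transitive zrel.
Proof.
move=> y x z /zrelP[xy hxy] /zrelP[yz hyz]; apply/zrelP.
by split=> [|i Fi]; [rewrite xy | rewrite hxy // hyz // -xy].
Qed.

Canonical zrel_equiv := EquivRel zrel zrel_refl zrel_sym zrel_trans.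

Definition ZP := {eq_quot zrel}.

Definition zact (g : torus R n) (z : ZP) : ZP :=
  \pi_ZP ((repr z).1, g * (repr z).2)%g.

Lemma zact_pi g (p : P) t : zact g (\pi_ZP (p, t)) = \pi_ZP (p, g * t)%g.
Proof.
rewrite /zact; case: piP => -[q u] /= /eqmodP/zrelP[/= pq h].
apply/eqmodP/zrelP; split=> //= i; rewrite -pq => Fi.
by rewrite !torusME h.
Qed.

Definition acts_freely (G : set (torus R n)) : Prop :=
  forall g z, G g -> zact g z = z -> g = 1%g.

(* F is meant to enumerate the facets of P; k is then s(P). *)
Definition s_number (k : nat) : Prop :=
  (exists G : set (torus R n),
     [/\ algebraic_subgroup G, acts_freely G & krull_dim G k]) /\
  (forall (G : set (torus R n)) l,
     algebraic_subgroup G -> acts_freely G -> krull_dim G l -> (l <= k)%N).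

End MomentAngle.

(* Main.v *)
Require Import Defs.
From mathcomp Require Import all_boot all_order all_algebra.
From mathcomp Require Import boolp classical_sets functions cardinality reals.
From mathcomp Require Import complex mpoly.
From mathcomp Require Import zify ring lra.

Set Implicit Arguments.
Unset Strict Implicit.
Unset Printing Implicit Defensive.

Import Order.TTheory GRing.Theory Num.Theory.

(** Both bounds compare a subgroup with the isotropy groups. Over a vertex [v]
    the isotropy group is the coordinate torus of the [d] facets through [v], so
    a subgroup that acts freely meets a [d]-dimensional coordinate torus
    trivially and should have dimension at most [n - d]. This bound is attained
    as soon as the facets can be coloured with [d] colours in such a way that
    facets with a common point have different colours: the elements whose
    coordinates multiply to [1] within every colour form a torus of dimension
    [n - d], and in an isotropy group each colour has at most one nontrivial
    coordinate, which is then the product over its colour, hence [1].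

    The colouring of an even simple polytope ([simple_even_coloring]) is built by
    sweeping the vertices in the order of a generic linear functional
    ([facet_coloring]). At a vertex [w] with at most one descending edge, the
    facets that have [w] as lowest vertex can take the missing colours. With two
    or more descending edges, all facets at [w] already have colours, and two of
    them, [k] and [l], meet at a lower neighbour of [w] unless the descending
    edges are exactly the two that leave [k] and [l]. In that case [w] is the top
    of the 2-face cut out by the other facets at [w]; all its other vertices see
    the same two remaining colours, and counting the edges of one colour shows
    that [k] and [l] share a colour only if the number of vertices is odd
    ([top_2face_colors]).

    The geometric input is the local structure at a vertex: the functionals of
    its [d] facets form a basis of the dual of the direction space
    ([vertex_kernel]) and every facet is left by one edge ([edge_vertex]). Both
    follow from one fact, [facet_separates]: a functional that supports the
    polytope at a point and is positive on a direction [y] can be tilted until it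
    defines a facet, without changing its value at [y].

    The upper bound on Krull dimensions avoids the general dimension theory. In a
    chain of irreducible closed sets, a polynomial that vanishes on one member
    but not on the next is algebraically independent of the polynomials that were
    independent on the smaller one, so a chain of length [l] yields [l]
    independent functions ([chain_alg_independent]). On the other hand, a closed
    subgroup is cut out by characters ([closed_subgroup_characters], by the
    linear independence of characters); if it meets the coordinate torus of [V]
    trivially, a power of every coordinate in [V] is on the subgroup a Laurent
    monomial in the other coordinates ([power_relations]). Hence the monomials of
    degree at most [B] restrict to [O(B ^ (n - #|V|))] functions
    ([few_characters]), too few for more than [n - #|V|] independent polynomials
    ([alg_independent_size]). The lower bound is the chain of coordinate subtori
    of the torus of the colouring; they are irreducible because two points are
    joined by a rational curve inside the subtorus ([subtorus_irreducible]). *)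

(** * Colouring by a vertex sweep *)

Section Combinatorics.
Local Open Scope nat_scope.

Lemma exists_injective_on (T : finType) (d : nat) (z : 'I_d) (A : {set T}) :
  #|A| = d -> exists f : T -> 'I_d, {in A &, injective f}.
Proof.
move=> Ad; exists (fun x => match @idP (x \in A) with
   | ReflectT h => cast_ord Ad (enum_rank_in h x) | _ => z end).
move=> x y Ax Ay; case: {-}_ / idP => // hx; case: {-}_ / idP => // hy.
move=> /cast_ord_inj e; have := congr1 enum_val e.
by rewrite !enum_rankK_in.
Qed.

Lemma double_count_parity (T U : finType) (E : T -> U -> bool) (A : {set U}) (B : {set T}) :
  (forall g, g \in A -> ~~ odd #|[set u in B | E u g]|) ->
  ~~ odd (\sum_(u in B) #|[set g in A | E u g]|).
Proof.
move=> h.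
have -> : \sum_(u in B) #|[set g in A | E u g]| = \sum_(g in A) #|[set u in B | E u g]|.
  under eq_bigr do rewrite -sum1dep_card.
  under [RHS]eq_bigr do rewrite -sum1dep_card.
  rewrite (exchange_big_dep (mem A)) //=; last by move=> i j _ /andP[].
  by apply: eq_bigr => g gA; apply: eq_bigl => u; rewrite gA.
elim/big_rec: _ => // g s gA os; rewrite oddD (negbTE os) addbF; exact: h.
Qed.

(** The combinatorial shadow of a simple polytope whose vertices are numbered
    along a linear functional: [I v] is the set of facets through [v] and
    [nb v i] the other end of the edge at [v] that leaves the facet [i]. Faces
    through [v] correspond to subsets [J] of [I v], and [lmin], [lmax] say that a
    local extremum on a face is a global one. *)
Section Coloring.
Variables (n d q : nat) (I : 'I_q -> {set 'I_n}) (nb : 'I_q -> 'I_n -> 'I_q).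
Hypothesis d_gt0 : 0 < d.
Hypothesis cardI : forall v, #|I v| = d.
Hypothesis nbD : forall v i, i \in I v -> nb v i != v.
Hypothesis nbP : forall v i u, i \in I v ->
  (I v :\ i \subset I u) = (u == v) || (u == nb v i).
Hypothesis lmin : forall v (J : {set 'I_n}), J \subset I v ->
  (forall i, i \in I v :\: J -> (v < nb v i)%N) -> forall u, J \subset I u -> v <= u.
Hypothesis lmax : forall v (J : {set 'I_n}), J \subset I v ->
  (forall i, i \in I v :\: J -> (nb v i < v)%N) -> forall u, J \subset I u -> u <= v.
Hypothesis even2 : forall v k l, k \in I v -> l \in I v -> k != l ->
  ~~ odd #|[set u | I v :\ k :\ l \subset I u]|.

Lemma nb_facet v i k : i \in I v -> k \in I v -> k != i -> k \in I (nb v i).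
Proof.
move=> iv kv ki.
have /fintype.subsetP : I v :\ i \subset I (nb v i) by rewrite nbP // eqxx orbT.
by apply; rewrite !inE ki.
Qed.

(** Let [K] be the set of facets at [w] other than [k] and [l]. Every vertex
    [u != w] of the 2-face of [K] has exactly one facet outside [K] of the colour
    [al] of [l], while every facet outside [K] that meets the 2-face does so in
    the two ends of an edge. If [k] had the colour [al] as well, then [w] would
    have two such facets, and the number of incidences, which is even, would exceed
    the number of vertices by one. *)
Lemma top_2face_colors (col : 'I_n -> 'I_d) (w : 'I_q) k l :
  (forall v : 'I_q, v < w -> {in I v &, injective col}) ->
  k \in I w -> l \in I w -> k != l -> nb w k < w -> nb w l < w ->
  col k != col l.
Proof.
move=> hcol kw lw kl nk nl.
apply/eqP => ckl.
set K := I w :\ k :\ l.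
have KI : K \subset I w by apply/fintype.subsetP => x; rewrite !inE => /and3P[].
have Kk : {in l |: K &, injective col}.
  move=> x y xK yK; apply: (hcol _ nk); apply: nb_facet => //.
  - by move: xK; rewrite !inE => /orP[/eqP->|/and3P[]].
  - by move: xK; rewrite !inE => /orP[/eqP->|/and3P[]] //; rewrite eq_sym.
  - by move: yK; rewrite !inE => /orP[/eqP->|/and3P[]].
  - by move: yK; rewrite !inE => /orP[/eqP->|/and3P[]] //; rewrite eq_sym.
have lK : l \notin K by rewrite !inE eqxx.
have kK : k \notin K by rewrite !inE eqxx andbF.
have d2 : d = #|K|.+2.
  have := cardsD1 k (I w); have := cardsD1 l (I w :\ k).
  by rewrite kw cardI !inE lw eq_sym kl /= => -> ->; rewrite /K.
pose al := col l.
pose B := [set u | K \subset I u].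
have Bw u : u \in B -> u != w -> u < w.
  rewrite inE => Ku uw; rewrite ltn_neqAle (inj_eq val_inj) uw /=.
  apply: (lmax KI) Ku => i; rewrite !inE => /andP[]; rewrite !negb_and !negbK.
  by case/or3P => [/eqP->|/eqP->|/negbTE->].
(* Incidences between vertices of the 2-face and facets of colour al off K. *)
have := double_count_parity (E := fun (u : 'I_q) (g : 'I_n) => g \in I u)
  (A := [set g | g \notin K & col g == al]) (B := B) _.
rewrite (bigD1 w) /=; last by rewrite inE.
have -> : [set g in [set g | g \notin K & col g == al] | g \in I w] = [set k; l].
  apply/finset.setP => g; rewrite !inE.
  case: (eqVneq g l) => [->|gl] /=; first by rewrite eqxx lw orbT.
  case: (eqVneq g k) => [->|gk] /=; first by rewrite ckl eqxx kw.
  by case: (g \in I w); rewrite ?andbF.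
rewrite cards2 kl (eq_bigr (fun=> 1)) => [|u /andP[uB uw]]; last first.
  have cu := hcol _ (Bw _ uB uw).
  have Ku : K \subset I u by move: uB; rewrite inE.
  have /card_gt0P[g] : 0 < #|[set g in [set g | g \notin K & col g == al] | g \in I u]|.
    have : al \in col @: I u.
      suff -> : col @: I u = [set: 'I_d]%SET by rewrite finset.in_setT.
      by apply/eqP; rewrite eqEcard finset.subsetT cardsT card_ord (card_in_imset cu) cardI leqnn.
    case/imsetP => g gu alg; apply/card_gt0P; exists g.
    rewrite 2!inE gu -alg eqxx !andbT.
    apply/negP => gK; have : l = g.
      by apply: Kk => //; rewrite ?finset.setU11 // finset.in_setU gK orbT.
    by move=> lg; rewrite lg gK in lK.
  rewrite 2!inE => /andP[/andP[gK /eqP cg] gu].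
  rewrite -(cards1 g); congr (#|pred_of_set _|); apply/finset.setP => h; rewrite 2!inE finset.in_set1.
  apply/idP/eqP => [/andP[/andP[hK /eqP ch] hu]|->]; last by rewrite gK gu cg eqxx.
  by apply: cu; rewrite // ch.
rewrite sum1dep_card.
have -> : [set x in B | x != w] = B :\ w by apply/finset.setP => x; rewrite !inE andbC.
have eB : ~~ odd #|B| by exact: even2.
rewrite (cardsD1 w) inE KI add1n /= negbK in eB.
move=> par; suff par2 : ~~ odd (2 + #|B :\ w|).
  by move: par2; rewrite oddD eB.
apply: par => g; rewrite inE => /andP[gK cg].
set S := [set u in B | _].
have [->|[u]] := finset.set_0Vmem S; first by rewrite cards0.
rewrite 2!inE => /andP[Ku gu].
have sgK : g |: K \subset I u by rewrite finset.subUset finset.sub1set gu.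
have : #|I u :\: (g |: K)| = 1.
  rewrite cardsD (finset.setIidPr sgK) cardI cardsU1 gK d2 add1n; exact: subSnn.
move=> /eqP/cards1P[i Ei].
have iu : i \in I u.
  have : i \in [set i]%SET by rewrite finset.set11.
  by rewrite -Ei inE => /andP[].
have gKE : g |: K = I u :\ i.
  by rewrite -Ei finset.setDDr finset.setDv finset.set0U (finset.setIidPr sgK).
suff -> : S = [set u; nb u i] by rewrite cards2 eq_sym nbD.
apply/finset.setP => x; rewrite !inE -nbP // -gKE finset.subUset finset.sub1set andbC.
by [].
Qed.

(** The colours of facets through the vertices before [t] are settled; [D]
    collects the facets left by a descending edge at the next vertex [w]. If [D]
    is empty, [w] is the global minimum; if [D] is a singleton, its facet has [w]
    as lowest vertex, so exactly this facet may be recoloured. *)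
Lemma coloring_prefix (t : nat) : t <= q ->
  exists col : 'I_n -> 'I_d,
    forall v : 'I_q, v < t -> {in I v &, injective col}.
Proof.
elim: t => [_|t IH tq]; first by exists (fun=> Ordinal d_gt0) => v; rewrite ltn0.
have [col hcol] := IH (ltnW tq).
set w := Ordinal tq.
have nltw (v : 'I_q) : v < t.+1 -> v = w \/ v < w.
  by rewrite ltnS leq_eqVlt => /orP[/eqP vt|]; [left; exact: val_inj|right].
have nbgt i : i \in I w -> ~~ (nb w i < w) -> w < nb w i.
  by move=> iw; rewrite -leqNgt leq_eqVlt => /orP[/eqP/val_inj e|//];
    have := nbD iw; rewrite -e eqxx.
pose D := [set i in I w | nb w i < w].
case: (ltngtP #|D| 1) => cD.
- have D0 : D = finset.set0 by apply/eqP; rewrite -cards_eq0; case: #|D| cD.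
  have [f finj] := exists_injective_on (Ordinal d_gt0) (cardI w).
  exists f => v /nltw[->//|vw]; have : w <= v; last by rewrite leqNgt vw.
  apply: (lmin (finset.sub0set (I w))) (finset.sub0set _) => i.
  rewrite !inE /= => iw; apply: nbgt => //; apply/negP => h.
  have iD : i \in D by rewrite inE iw.
  by rewrite D0 inE in iD.
- exists col => v /nltw[-> | ]; last exact: hcol.
  move=> k l kw lw ckl; apply/eqP; apply: contraTT isT => kl.
  have [D0|[j]] := finset.set_0Vmem (D :\ k :\ l); last first.
    rewrite !inE => /and4P[jl jk jw jD].
    have := hcol _ jD k l (nb_facet jw kw _) (nb_facet jw lw _) ckl.
    by rewrite eq_sym jk eq_sym jl => /(_ isT isT) e; rewrite e eqxx in kl.
  have Dkl : D = [set k; l].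
    apply/eqP; rewrite eqEcard cards2 kl cD andbT; apply/fintype.subsetP => x xD.
    have : x \in D :\ k :\ l = false by rewrite D0 inE.
    by rewrite !finset.in_setD1 xD andbT !inE; case: (x == l) (x == k) => -[].
  have kD : k \in D by rewrite Dkl !inE eqxx.
  have lD : l \in D by rewrite Dkl !inE eqxx orbT.
  move: kD lD; rewrite !inE kw lw /= => kD lD.
  have hcol' : forall v : 'I_q, v < w -> {in I v &, injective col} by [].
  by have := top_2face_colors hcol' kw lw kl kD lD; rewrite ckl eqxx.
have [i Di] : exists i, D = [set i]%SET by apply/cards1P/eqP.
have iD : i \in D by rewrite Di finset.set11.
have iw : i \in I w by move: iD; rewrite inE => /andP[].
(* The other d - 1 facets at w miss one colour, which is forced for i. *)
have [c cP] : exists c, c \notin col @: (I w :\ i).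
  apply/existsP; rewrite -negb_forall; apply/negP => /forallP h.
  have : #|[set: 'I_d]%SET| <= #|col @: (I w :\ i)|.
    by apply/subset_leq_card/fintype.subsetP => x _; exact: h.
  rewrite cardsT card_ord => /leq_trans/(_ (leq_imset_card _ _)).
  by have := cardsD1 i (I w); rewrite iw cardI add1n => {1}->; rewrite ltnn.
have iF (u : 'I_q) : u < w -> i \notin I u.
  move=> uw; apply/negP => iu; have : w <= u; last by rewrite leqNgt uw.
  apply: (@lmin w [set i]%SET); rewrite ?finset.sub1set // => j; rewrite !inE => /andP[ji jw].
  by apply: nbgt => //; apply: contraNN ji => h; rewrite -finset.in_set1 -Di inE jw.
have inb : nb w i < w by move: iD; rewrite inE iw.
have hi : {in I w :\ i &, injective col}.
  by move=> k l; rewrite !inE => /andP[ki kw] /andP[li lw]; apply: (hcol _ inb);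
    exact: nb_facet.
exists (fun j => if j == i then c else col j) => v /nltw[->|vw] k l kv lv.
  have [->|ki] := eqVneq k i; have [->|li] := eqVneq l i => //.
  - by move=> e; case/imsetP: cP; exists l; rewrite // !inE li.
  - by move=> e; case/imsetP: cP; exists k; rewrite // !inE ki.
  by apply: hi; rewrite !inE ?ki ?li.
have [ki|_] := eqVneq k i; first by have := iF v vw; rewrite -ki kv.
have [li|_] := eqVneq l i; first by have := iF v vw; rewrite -li lv.
by apply: (hcol v vw).
Qed.

Lemma facet_coloring :
  exists col : 'I_n -> 'I_d, forall v : 'I_q, {in I v &, injective col}.
Proof.
have [col hcol] := coloring_prefix (leqnn q).
by exists col => v; exact/hcol/ltn_ord.
Qed.

End Coloring.

End Combinatorics.

(** * Linear functionals and subspaces *)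
Section LinearFunctionals.
Local Open Scope ring_scope.
Context {R : fieldType} {m : nat}.
Implicit Types (x y : 'rV[R]_m) (a c : 'cV[R]_m) (s : seq 'rV[R]_m).

Definition dot x a : R := (x *m a) 0 0.

Lemma dotDl x y a : dot (x + y) a = dot x a + dot y a.
Proof. by rewrite /dot mulmxDl mxE. Qed.
Lemma dotBl x y a : dot (x - y) a = dot x a - dot y a.
Proof. by rewrite /dot mulmxBl !mxE. Qed.
Lemma dotZl k x a : dot (k *: x) a = k * dot x a.
Proof. by rewrite /dot -scalemxAl mxE. Qed.
Lemma dot_suml I (r : seq I) (Q : pred I) (F : I -> 'rV[R]_m) a :
  dot (\sum_(i <- r | Q i) F i) a = \sum_(i <- r | Q i) dot (F i) a.
Proof. by rewrite /dot mulmx_suml summxE. Qed.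
Lemma dotDr x a c : dot x (a + c) = dot x a + dot x c.
Proof. by rewrite /dot mulmxDr mxE. Qed.
Lemma dotZr k x a : dot x (k *: a) = k * dot x a.
Proof. by rewrite /dot -scalemxAr mxE. Qed.
Lemma dotNr x a : dot x (- a) = - dot x a.
Proof. by rewrite /dot mulmxN mxE. Qed.
Lemma dot_sumr I (r : seq I) (Q : pred I) (F : I -> 'cV[R]_m) x :
  dot x (\sum_(i <- r | Q i) F i) = \sum_(i <- r | Q i) dot x (F i).
Proof. by rewrite /dot mulmx_sumr summxE. Qed.
Lemma dot0r x : dot x 0 = 0.
Proof. by rewrite /dot mulmx0 mxE. Qed.
Lemma dot0l a : dot 0 a = 0.
Proof. by rewrite /dot mul0mx mxE. Qed.

Lemma separate_subspace (W : {vspace 'rV[R]_m}) x : x \notin W ->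
  exists2 a, forall y, y \in W -> dot y a = 0 & dot x a != 0.
Proof.
move=> xW; pose p y := y - projv W y.
have [j pj] : exists j, p x 0 j != 0.
  apply/existsP; apply: contraNT xW; rewrite negb_exists => /forallP h.
  have /eqP : p x = 0.
    by apply/rowP => j; have := h j; rewrite negbK => /eqP->; rewrite mxE.
  by rewrite subr_eq0 => /eqP->; exact: memv_proj.
pose M := \matrix_i (p (delta_mx 0 i)).
have pM y : y *m M = p y.
  rewrite mulmx_sum_row {2}(row_sum_delta y) /p linear_sum -sumrB /=.
  by apply: eq_bigr => i _; rewrite rowK /p linearZ /= scalerBr.
have dM y : dot y (col j M) = p y 0 j by rewrite /dot colE mulmxA -colE mxE pM.
by exists (col j M) => [y yW|]; rewrite dM // /p projv_id // subrr mxE.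
Qed.

Lemma span_dot_eq0 s a y : (forall x, x \in s -> dot x a = 0) ->
  y \in <<s>>%VS -> dot y a = 0.
Proof.
move=> h /(@coord_span _ _ _ (in_tuple s)) ->.
rewrite dot_suml big1 // => i _; rewrite dotZl h ?mulr0 // mem_nth //.
Qed.

Lemma dim_add_line (W : {vspace 'rV[R]_m}) y :
  y \notin W -> \dim (W + <[y]>) = (\dim W).+1.
Proof.
move=> yW; rewrite dimv_disjoint_sum ?dim_vline.
  by case: eqP yW => [->|]; rewrite ?mem0v ?addn1.
apply/eqP; rewrite -subv0; apply/subvP => z; rewrite memv_cap memv0 => /andP[zW].
case/vlineP => k zk; move: zW; rewrite zk; have [->|k0] := eqVneq k 0.
  by rewrite scale0r.
by rewrite rpredZeq (negbTE k0) (negbTE yW).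
Qed.

End LinearFunctionals.

(** * Convex and affine hulls *)
Section Geometry.
Local Open Scope ring_scope.
Context {R : realType} {m : nat}.
Implicit Types (x y w : 'rV[R]_m) (a c : 'cV[R]_m) (A P : set 'rV[R]_m).
Implicit Types (s : seq 'rV[R]_m).

Lemma conv_dot_le (X : set 'rV[R]_m) a (b : R) y :
  (forall x, X x -> dot x a <= b) -> conv_hull X y -> dot y a <= b.
Proof.
move=> h [k [p [c [Xp c0 c1 ->]]]]; rewrite dot_suml -[b]mul1r -c1 mulr_suml.
by apply: ler_sum => i _; rewrite dotZl ler_wpM2l ?h.
Qed.

Lemma sub_conv (X : set 'rV[R]_m) x : X x -> conv_hull X x.
Proof.
move=> Xx; exists 1, (fun=> x), (fun=> 1); split=> //; rewrite ?big_ord1 //.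
by rewrite scale1r.
Qed.

Lemma sub_aff A x : A x -> aff_hull A x.
Proof.
move=> Xx; exists 1, (fun=> x), (fun=> 1); split=> //; rewrite ?big_ord1 //.
by rewrite scale1r.
Qed.

(** A convex combination attains an upper bound of a functional only if all
    points of positive weight do; points of weight zero are moved to one of
    those. *)
Lemma conv_face (X : set 'rV[R]_m) a (b : R) y :
  (forall x, X x -> dot x a <= b) -> conv_hull X y -> dot y a = b ->
  conv_hull [set x | X x /\ dot x a = b]%classic y.
Proof.
move=> h [k [p [c [Xp c0 c1 ->]]]] /eqP.
rewrite -subr_eq0 -oppr_eq0 opprB dot_suml -{1}[b]mul1r -c1 mulr_suml -sumrB.
rewrite psumr_eq0 => [|i _]; last by rewrite dotZl -mulrBr mulr_ge0 // subr_ge0 h.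
move=> /allP e.
have {}e i : c i = 0 \/ dot (p i) a = b.
  have := e i (mem_index_enum _); rewrite dotZl -mulrBr mulf_eq0 subr_eq0.
  by case/orP => /eqP; auto.
have [i0 ci0] : exists i, c i != 0.
  apply/existsP; apply: contraT; rewrite negb_exists => /forallP h0.
  by move: c1; rewrite big1 => [/eqP|i _]; rewrite 1?eq_sym ?oner_eq0 //;
    have := h0 i; rewrite negbK => /eqP.
exists k, (fun i => if c i == 0 then p i0 else p i), c; split=> // [i|].
  case: eqP => [_|ci]; split=> //; first by case: (e i0) => // /eqP; rewrite (negbTE ci0).
  by case: (e i).
by apply: eq_bigr => i _; case: eqP => // ->; rewrite !scale0r.
Qed.

Lemma aff_hull_dot A a (b : R) y :
  (forall x, A x -> dot x a = b) -> aff_hull A y -> dot y a = b.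
Proof.
move=> h [k [p [c [Xp c1 ->]]]]; rewrite dot_suml -[b]mul1r -c1 mulr_suml.
by apply: eq_bigr => i _; rewrite dotZl h.
Qed.

(** Linear combinations of differences [x - w] become affine combinations once
    the missing weight is put on [w] itself. *)
Lemma aff_hullE A w s (U : {vspace 'rV[R]_m}) : A w ->
  (forall x, x \in s -> A x) -> U = <<[seq x - w | x <- s]>>%VS ->
  (forall x, A x -> x - w \in U) ->
  aff_hull A = [set x | x - w \in U]%classic.
Proof.
move=> Aw As UE AU; apply/seteqP; split=> [x [k [p [c [Xp c1 ->]]]]|x] /=.
  rewrite -[w]scale1r -c1 scaler_suml -sumrB; apply: memv_suml => i _.
  by rewrite -scalerBr memvZ // AU.
rewrite UE => /(@coord_span _ _ _ (in_tuple _)) xE.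
set t := [seq x - w | x <- s] in xE; pose k (i : 'I_(size t)) : R := coord (in_tuple t) i (x - w).
have uK (i : 'I_(size t).+1.-1) : unlift ord0 (lift ord0 i) = Some i by exact: fintype.liftK.
exists (size t).+1, (fun i => oapp (fun j => s`_(j : 'I_(size t))) w (unlift ord0 i)),
  (fun i => oapp k (1 - \sum_j k j) (unlift ord0 i)); split.
- move=> i; case: unliftP => [j|] _ //=; apply: As; apply: mem_nth.
  by have := ltn_ord j; move: (j : nat) => j'; rewrite /= /t size_map.
- rewrite big_ord_recl unlift_none /=.
  rewrite [X in _ + X](eq_bigr k) => [|i _]; first by rewrite subrK.
  by rewrite (uK i).
rewrite big_ord_recl unlift_none /=.
rewrite (eq_bigr (fun i => k i *: s`_i)) => [|i _]; last first.
  by rewrite (uK i).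
rewrite scalerBl scale1r scaler_suml -[LHS](subrK w) xE addrC -addrA.
congr (_ + _); rewrite addrC -sumrB; apply: eq_bigr => i _.
rewrite -scalerBr (nth_map 0) //.
by have := ltn_ord i; move: (i : nat) => i'; rewrite /= /t size_map.
Qed.

Lemma seq_argmin (T : eqType) (t : seq T) (Q : pred T) (f : T -> R) :
  has Q t -> exists p, [/\ p \in t, Q p & forall r, r \in t -> Q r -> f p <= f r].
Proof.
elim: t => //= z t IH; case: (boolP (has Q t)) => [/IH[p [xt Qx xmin]] _|ht].
  case: (boolP (Q z && (f z <= f p))) => [/andP[Qz zx]|nz].
    exists z; split; rewrite ?mem_head // => r; rewrite inE => /predU1P[->//|yt] Qy.
    exact: le_trans zx (xmin _ yt Qy).
  exists p; split; rewrite ?inE ?xt ?orbT // => r; rewrite inE => /predU1P[->|yt] Qy.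
    by move: nz; rewrite Qy /= -ltNge => /ltW.
  exact: xmin.
rewrite orbF => Qz; exists z; split; rewrite ?mem_head // => r.
rewrite inE => /predU1P[->//|yt] Qy; case/negP: ht; apply/hasP; by exists r.
Qed.

(** * Tilting a supporting functional to a facet *)
Section Polytope.
Variables (P : set 'rV[R]_m) (s : seq 'rV[R]_m) (d : nat).
Variables (x0 : 'rV[R]_m) (U : {vspace 'rV[R]_m}).
Hypothesis PE : P = conv_hull [set` s]%classic.
Hypothesis dimU : \dim U = d.
Hypothesis affP : aff_hull P = [set x | x - x0 \in U]%classic.

Lemma gen_P x : x \in s -> P x.
Proof. by move=> xs; rewrite PE; apply: sub_conv. Qed.

Lemma P_subU x y : P x -> P y -> x - y \in U.
Proof.
move=> /sub_aff + /sub_aff; rewrite affP /= => hx hy.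
by have := rpredB hx hy; rewrite opprB subrKA.
Qed.

(** The differences [x - w] of the generators span the direction space [U],
    in the dual form in which it is needed. *)
Lemma U_dot_eq0 w a : P w -> (forall x, x \in s -> dot (x - w) a = 0) ->
  forall u, u \in U -> dot u a = 0.
Proof.
move=> Pw h u uU.
have hP x : P x -> dot x a = dot w a.
  rewrite PE => xP; apply/eqP; rewrite eq_le; apply/andP; split.
    by apply: (conv_dot_le _ xP) => z /= /h/eqP; rewrite dotBl subr_eq0 => /eqP->.
  rewrite -lerN2 -!dotNr; apply: (conv_dot_le _ xP) => z /= /h/eqP.
  by rewrite !dotNr dotBl subr_eq0 => /eqP->.
have : aff_hull P (w + u).
  rewrite affP /= addrAC rpredD //; have := sub_aff Pw; by rewrite affP.
move=> /(aff_hull_dot hP); rewrite dotDl => /eqP.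
by rewrite addrC -subr_eq0 addrK => /eqP.
Qed.

Definition valid w c := forall x, x \in s -> dot (x - w) c <= 0.
(** The directions at [w] of the face on which a valid functional [c] is
    maximal. *)
Definition active w c := <<[seq x - w | x <- s & (dot (x - w) c == 0)%R]>>%VS.

Lemma active_dot w c u : u \in active w c -> dot u c = 0.
Proof.
by apply: span_dot_eq0 => x /mapP[z]; rewrite mem_filter => /andP[/eqP zc _] ->.
Qed.

Lemma active_subU w c : P w -> (active w c <= U)%VS.
Proof.
move=> Pw; apply/span_subvP => x /mapP[z]; rewrite mem_filter => /andP[_ zs] ->.
by apply: P_subU => //; exact: gen_P.
Qed.

Lemma active_gen w c x : x \in s -> dot (x - w) c = 0 -> x - w \in active w c.
Proof.
by move=> xs xc; rewrite memv_span //; apply: map_f; rewrite mem_filter xc eqxx.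
Qed.

Lemma active_dim_lt w c y : P w -> y \in U -> 0 < dot y c ->
  y \notin active w c /\ (\dim (active w c + <[y]>) = (\dim (active w c)).+1 /\
    (active w c + <[y]> <= U)%VS).
Proof.
move=> Pw yU yc; have yW : y \notin active w c.
  by apply/negP => /active_dot yc0; rewrite yc0 ltxx in yc.
by rewrite dim_add_line // subv_add active_subU // -memvE.
Qed.

(** As long as the active directions together with [y] do not span [U], some
    functional [a'] vanishes on them but not on all of [U]. Adding the largest
    multiple of [a'] that keeps [c] valid makes a further generator active
    without changing the value at [y]; the rank of the active directions grows
    until it is [d - 1]. *)
Lemma tilt_to_facet w y c : P w -> y \in U -> valid w c -> 0 < dot y c ->
  exists c', [/\ valid w c', 0 < dot y c' & (\dim (active w c')).+1 = d].
Proof.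
move=> Pw yU.
have [k] : exists k, (d <= k + \dim (active w c))%N by exists d; rewrite leq_addr.
elim: k c => [|k IH] c dk vc yc; have [yW [dimW WU]] := active_dim_lt Pw yU yc.
  by have := dimvS WU; rewrite dimW dimU ltnNge dk.
have := dimvS WU; rewrite dimW dimU leq_eqVlt => /orP[/eqP dW|dW].
  by exists c.
have : ~~ (U <= active w c + <[y]>)%VS.
  by apply/negP => /dimvS; rewrite dimW dimU leqNgt dW.
case/subvPn => u uU /separate_subspace[a aW au].
have [z zs az] : exists2 z, z \in s & dot (z - w) a != 0.
  apply: contrapT => /forall2NP h; move/eqP: au; apply.
  apply: (U_dot_eq0 Pw) uU => x xs; case: (h x) => // /negP; rewrite negbK => /eqP //.
have {z zs az} [a' [a'W [z zs az]]] : exists a', (forall v, v \in (active w c + <[y]>)%VS -> dot v a' = 0)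
    /\ exists2 z, z \in s & 0 < dot (z - w) a'.
  case: (ltgtP (dot (z - w) a) 0) az => // az _.
    exists (- a); split; first by move=> v /aW; rewrite dotNr => ->; rewrite oppr0.
    by exists z => //; rewrite dotNr oppr_gt0.
  by exists a; split => //; exists z.
have hs : has (fun x => 0 < dot (x - w) a') s by apply/hasP; exists z.
have [x [xs xa xmin]] := seq_argmin (fun x => - dot (x - w) c / dot (x - w) a') hs.
(* t is the largest step along a' for which c + t a' stays valid. *)
set t := - dot (x - w) c / dot (x - w) a' in xmin.
have t0 : 0 <= t by apply: divr_ge0; [rewrite oppr_ge0 vc|exact: ltW].
have ya : dot y a' = 0 by apply: a'W; rewrite memvE addvSr.
have ca v : v \in active w c -> dot v a' = 0.
  by move=> vW; apply: a'W; apply: (subvP (addvSl _ _)).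
have wc : dot (x - w) (c + t *: a') = 0.
  by rewrite dotDr dotZr /t divfK ?gt_eqF // subrr.
apply: (IH (c + t *: a')).
- rewrite (leq_trans dk) // addSn -addnS leq_add2l.
  have xW : x - w \notin active w c.
    by apply/negP => /ca h; rewrite h ltxx in xa.
  rewrite -(dim_add_line xW); apply: dimvS; rewrite subv_add -memvE active_gen // andbT.
  apply/span_subvP => v /mapP[v']; rewrite mem_filter => /andP[/eqP vc0 vs] ->.
  apply: active_gen => //; rewrite dotDr dotZr vc0 add0r ca ?mulr0 //.
  exact: active_gen.
- move=> v vs; rewrite dotDr dotZr; case: (ltP 0 (dot (v - w) a')) => va.
    have := xmin _ vs va; rewrite ler_pdivlMr // -subr_le0 opprK addrC //.
  by rewrite -[leRHS]addr0 lerD ?vc // mulr_ge0_le0.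
by rewrite dotDr dotZr ya mulr0 addr0.
Qed.

Lemma valid_P w c x : P w -> valid w c -> P x -> dot x c <= dot w c.
Proof.
move=> Pw vc; rewrite PE => /(conv_dot_le (a := c) (b := dot w c)); apply => z /= zs.
by rewrite -subr_le0 -dotBl vc.
Qed.

Lemma conv_sub_span (X : set 'rV[R]_m) (W : {vspace 'rV[R]_m}) w x :
  (forall z, X z -> z - w \in W) -> conv_hull X x -> x - w \in W.
Proof.
move=> XW [k [p [c [Xp _ c1 ->]]]].
rewrite -[w]scale1r -c1 scaler_suml -sumrB; apply: memv_suml => i _.
by rewrite -scalerBr memvZ // XW.
Qed.

(** The tilted functional defines a facet. Any other description [a], [b] of that
    facet is a positive multiple of it on [U]: both vanish on the active
    directions, whose span has codimension one, and both are negative on some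
    generator. *)
Lemma facet_separates w y c : P w -> y \in U -> valid w c -> 0 < dot y c ->
  exists A, [/\ facet P A, A w & forall a (b : R),
    (forall x, P x -> dot x a <= b) -> A = [set x | P x /\ dot x a = b]%classic ->
    0 < dot y a].
Proof.
move=> Pw yU vc0 yc0; have [c' [vc yc dimc]] := tilt_to_facet Pw yU vc0 yc0.
move: c' vc yc dimc => {vc0 yc0}c vc yc dimc.
have [yW [dimW WU]] := active_dim_lt Pw yU yc.
pose A := [set x | P x /\ dot x c = dot w c]%classic.
have Aw : A w by split.
have UE : U = (active w c + <[y]>)%VS.
  by apply/esym/eqP; rewrite eqEdim WU dimW dimc dimU leqnn.
have actA x : x \in s -> dot (x - w) c = 0 -> A x.
  by move=> xs; rewrite dotBl => /subr0_eq xw; split; [exact: gen_P|].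
have affA : aff_hull A = [set x | x - w \in active w c]%classic.
  apply: (@aff_hullE _ _ [seq x <- s | dot (x - w) c == 0]) => //.
    by move=> x; rewrite mem_filter => /andP[/eqP ? ?]; exact: actA.
  move=> x [Px xc]; rewrite PE in Px.
  apply: conv_sub_span (conv_face _ Px xc) => [z [/= zs zc]|z zs].
    by apply: active_gen; rewrite // dotBl zc subrr.
  by apply: (valid_P Pw vc); exact: gen_P.
exists A; split=> // [|a b ab AE].
  split; first by exists c, (dot w c); split=> // x; exact: valid_P.
  exists (\dim (active w c)); split; first by exists x0, U; rewrite dimc.
  by exists w, (active w c).
have wb : dot w a = b by move: Aw; rewrite AE => -[].
have [x xs xc] : exists2 x, x \in s & dot (x - w) c < 0.
  apply: contrapT => /forall2NP h; move: yc; rewrite (U_dot_eq0 Pw _ yU) ?ltxx // => x xs.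
  by case: (h x) => // /negP; rewrite -leNgt => xc; apply/eqP; rewrite eq_le vc.
have xa : dot (x - w) a < 0.
  rewrite dotBl subr_lt0 wb lt_neqAle ab ?andbT; last exact: gen_P.
  apply/eqP => xb; have : A x by rewrite AE; split; [exact: gen_P|].
  by case=> _ e; move: xc; rewrite dotBl e subrr ltxx.
have : x - w \in U by apply: P_subU => //; exact: gen_P.
rewrite UE => /memv_addP[v vW [z /vlineP[k zE] xE]].
move: xc xa; rewrite xE zE !dotDl !dotZl (active_dot vW) add0r pmulr_llt0 // => k0.
rewrite (span_dot_eq0 _ vW) ?add0r ?nmulr_rlt0 // => u /mapP[z' + ->].
rewrite mem_filter => /andP[/eqP zc zs].
by have := actA _ zs zc; rewrite AE => -[_ zb]; rewrite dotBl zb wb subrr.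
Qed.


(** ** Vertices and faces *)
Lemma vertexE v : vertices P v ->
  [/\ P v, v \in s & exists c, forall x, P x -> x != v -> dot x c < dot v c].
Proof.
move=> [c [b [cb vE]]].
have [Pv vb] : P v /\ dot v c = b.
  by have : [set v]%classic v by []; rewrite vE.
split=> //; last first.
  exists c => x Px xv; rewrite lt_neqAle vb; apply/andP; split; last exact: cb.
  apply/eqP => xb; have : [set v]%classic x by rewrite vE.
  by move=> xv'; rewrite xv' eqxx in xv.
move: (Pv); rewrite PE => /(conv_face (a := c) (b := b)) -/(_ _ vb).
case=> [x /= /gen_P/cb//|k [p [e [+ _ e1 _]]]].
case: k p e e1 => [p e|k p e _ /(_ ord0)[ps pb]].
  by rewrite big_ord0 => /eqP; rewrite eq_sym oner_eq0.
suff -> : v = p ord0 by [].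
by have : [set v]%classic (p ord0) by rewrite vE; split => //; exact: gen_P.
Qed.

Lemma vertexI v c : P v -> (forall x, x \in s -> x != v -> dot x c < dot v c) ->
  vertices P v.
Proof.
move=> Pv h; exists c, (dot v c).
have hs x : x \in s -> dot x c <= dot v c.
  by move=> xs; have [->//|/(h x xs)/ltW] := eqVneq x v.
split=> [x|]; first by rewrite PE; apply: conv_dot_le => z; exact: hs.
apply/seteqP; split=> [x ->//|x [Px xc]]; rewrite PE in Px.
apply/eqP; rewrite -subr_eq0 -memv0.
apply: conv_sub_span (conv_face _ Px xc) => [z [/= zs zc]|z /hs //].
rewrite memv0 subr_eq0; apply: contraT => zv.
by have := h z zs zv; rewrite zc ltxx.
Qed.

(** Tool for perturbations: on a finite set, a large multiple of a negative
    function absorbs any other function. *)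
Lemma dominate (Q : pred 'rV[R]_m) (f g : 'rV[R]_m -> R) :
  (forall x, x \in s -> Q x -> f x < 0) ->
  exists2 M, 0 < M & forall x, x \in s -> Q x -> M * f x + g x < 0.
Proof.
elim: s => [|z t IH] h; first by exists 1.
have [M M0 hM] : exists2 M : R, 0 < M & forall x, x \in t -> Q x -> M * f x + g x < 0.
  by apply: IH => x xt; apply: h; rewrite inE xt orbT.
pose N := `|g z / f z| + 1.
have N0 : 0 < N by rewrite ltr_wpDl.
exists (M + N) => [|x]; first exact: addr_gt0.
rewrite inE => /predU1P[->|xt] Qx; rewrite mulrDl.
  have fz : f z < 0 by apply: h; rewrite ?mem_head.
  have : N * f z + g z < 0.
    have gz : g z = g z / f z * f z by rewrite divfK // lt_eqF.
    rewrite /N [X in _ + X]gz -mulrDl pmulr_rlt0 //.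
    by have := ler_norm (- (g z / f z)); rewrite normrN; lra.
  have Mf : M * f z < 0 by rewrite pmulr_rlt0.
  lra.
have fx : f x < 0 by apply: h; rewrite // inE xt orbT.
have Nf : N * f x < 0 by rewrite pmulr_rlt0.
have := hM x xt Qx; lra.
Qed.

(** A vertex of a face is a vertex of the polytope: combine a large multiple of
    the functional of the face with the functional that singles out the vertex
    inside the face. *)
Lemma face_vertexI v a (b : R) c : P v -> (forall x, P x -> dot x a <= b) ->
  dot v a = b ->
  (forall x, x \in s -> dot x a = b -> x != v -> dot x c < dot v c) ->
  vertices P v.
Proof.
move=> Pv ab va h.
have [x xs|M M0 hM] := @dominate (fun x => dot x a != b) (fun x => dot x a - b)
  (fun x => dot x c - dot v c).
  by move=> xb; rewrite subr_lt0 lt_neqAle xb ab //; exact: gen_P.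
apply: (@vertexI v (M *: a + c)) => // x xs xv; rewrite !dotDr !dotZr.
have [xb|/(hM x xs)] := eqVneq (dot x a) b.
  by rewrite xb va ltrD2l h.
by rewrite va; lra.
Qed.

Lemma face_vertices a (b : R) : (forall x, P x -> dot x a <= b) ->
  let Q := [set x | P x /\ dot x a = b]%classic in
  vertices Q = [set v | vertices P v /\ Q v]%classic.
Proof.
move=> ab Q; apply/seteqP; split=> [v [c [b' [cb vE]]]|v [[c [b' [cb vE]]] Qv]].
  have [Qv vb] : Q v /\ dot v c = b'.
    by have : [set v]%classic v by []; rewrite vE.
  have [Pv va] := Qv.
  split=> //; apply: (@face_vertexI v a b c) => // x xs xb xv.
  have Qx : Q x by split=> //; exact: gen_P.
  rewrite vb lt_neqAle cb // andbT; apply/eqP => xb'.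
  have : [set v]%classic x by rewrite vE.
  by move=> xv'; rewrite xv' eqxx in xv.
exists c, b'; split; first by move=> x [/cb].
have vb : dot v c = b' by have : [set v]%classic v by []; rewrite vE => -[].
apply/seteqP; split=> [x ->//|x [[Px _] xb]].
by rewrite vE.
Qed.

(** A functional that separates the generators has a unique minimum on the
    generators of a face. *)
Lemma face_min_vertex phi a (b : R) : {in s &, injective (fun x => dot x phi)} ->
  (forall x, P x -> dot x a <= b) -> (exists2 x, P x & dot x a = b) ->
  exists2 v, vertices P v & dot v a = b.
Proof.
move=> phi_inj ab [x Px xb].
have hs : has (fun x => dot x a == b) s.
  move: Px; rewrite PE => /(conv_face (a := a) (b := b)) -/(_ _ xb).
  case=> [z /= /gen_P/ab//|k [p [e [+ _ e1 _]]]].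
  case: k p e e1 => [p e|k p e _ /(_ ord0)[ps pb]].
    by rewrite big_ord0 => /eqP; rewrite eq_sym oner_eq0.
  by apply/hasP; exists (p ord0) => //; apply/eqP.
have [v [vs /eqP va vmin]] := seq_argmin (fun x => dot x phi) hs.
exists v => //; apply: (@face_vertexI v a b (- phi)) => // [|z zs zb zv].
  exact: gen_P.
rewrite !dotNr ltrN2 lt_neqAle vmin ?zb // andbT.
by apply: contra_neq zv => /phi_inj ->.
Qed.

(** ** Local structure at a vertex of a simple polytope *)
Section Facets.
Variables (n : nat) (F : 'I_n -> set 'rV[R]_m) (a : 'I_n -> 'cV[R]_m) (b : 'I_n -> R).
Hypothesis facetF : forall A, facet P A -> exists i, F i = A.
Hypothesis Fle : forall i x, P x -> dot x (a i) <= b i.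
Hypothesis FE : forall i, F i = [set x | P x /\ dot x (a i) = b i]%classic.

(** The facets through a point; an intersection of facets is handled as the face
    maximizing the sum of their functionals, see [sum_facet_eq]. *)
Definition inc x : {set 'I_n} := [set i | `[< F i x >]]%SET.

Lemma incP x i : reflect (F i x) (i \in inc x).
Proof. by rewrite inE; apply: asboolP. Qed.

Lemma inc_dot x i : P x -> (i \in inc x) = (dot x (a i) == b i).
Proof.
move=> Px; apply/incP/eqP; rewrite FE; first by case.
by split.
Qed.

Lemma facet_separates_inc w y c : P w -> y \in U -> valid w c -> 0 < dot y c ->
  exists2 i, i \in inc w & 0 < dot y (a i).
Proof.
move=> Pw yU vc yc; have [A [/facetF[i FA] Aw h]] := facet_separates Pw yU vc yc.
exists i; first by apply/incP; rewrite FA.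
by apply: h => [x|]; [exact: Fle|rewrite -FA FE].
Qed.

Lemma sum_facet_le (J : {set 'I_n}) x : P x ->
  dot x (\sum_(j in J) a j) <= \sum_(j in J) b j.
Proof. by move=> Px; rewrite dot_sumr; apply: ler_sum => j _; exact: Fle. Qed.

Lemma sum_facet_eq (J : {set 'I_n}) x : P x ->
  dot x (\sum_(j in J) a j) = \sum_(j in J) b j <-> J \subset inc x.
Proof.
move=> Px; rewrite dot_sumr; split => [/eqP|/fintype.subsetP Jx].
  rewrite -subr_eq0 -oppr_eq0 opprB -sumrB psumr_eq0 => [/allP h|j _].
    apply/fintype.subsetP => j jJ; rewrite inc_dot //.
    by have := h j (mem_index_enum _); rewrite jJ subr_eq0 eq_sym.
  by rewrite subr_ge0 Fle.
by apply: eq_bigr => j /Jx; rewrite inc_dot // => /eqP.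
Qed.

Lemma valid_sum w (J : {set 'I_n}) : P w -> J \subset inc w -> valid w (\sum_(j in J) a j).
Proof.
move=> Pw /(sum_facet_eq J Pw) wJ x /gen_P Px.
by rewrite dotBl wJ subr_le0 sum_facet_le.
Qed.

(** A direction [y != 0] killed by all facet functionals at [w] is impossible:
    the functional that singles out [w] can be perturbed to be nonzero on [y],
    and separation along [y] or [-y] gives a facet functional positive on it. *)
Lemma vertex_kernel w y : vertices P w -> y \in U ->
  (forall i, i \in inc w -> dot y (a i) = 0) -> y = 0.
Proof.
move=> /vertexE[Pw ws [c0 c0P]] yU ya; apply: contrapT => /eqP y0.
have strict x : x \in s -> x != w -> dot (x - w) c0 < 0.
  by move=> /gen_P Px xw; rewrite dotBl subr_lt0 c0P.
have [c vc yc] : exists2 c, valid w c & dot y c != 0.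
  have [yc0|] := eqVneq (dot y c0) 0; last first.
    by exists c0 => // x xs; have [->|/(strict x xs)/ltW//] := eqVneq x w; rewrite subrr dot0l.
  have [|d' _ yd] := @separate_subspace _ _ 0 y; first by rewrite memv0.
  have [M M0 hM] := @dominate (fun x => x != w) (fun x => dot (x - w) c0)
    (fun x => dot (x - w) d') strict.
  exists (M *: c0 + d') => [x xs|]; rewrite dotDr dotZr ?yc0 ?mulr0 ?add0r //.
  by have [->|/(hM x xs)/ltW//] := eqVneq x w; rewrite subrr !dot0l mulr0 addr0.
have {y0} [y' [yU' yc' ya']] : exists y', [/\ y' \in U, 0 < dot y' c &
    forall i, i \in inc w -> dot y' (a i) = 0].
  case: (ltgtP (dot y c) 0) yc => // yc _; last by exists y.
  exists (- 1 *: y); split; first by rewrite memvZ.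
    by rewrite dotZl mulN1r oppr_gt0.
  by move=> i iw; rewrite dotZl ya ?mulr0.
have [i iw] := facet_separates_inc Pw yU' vc yc'.
by rewrite ya' // ltxx.
Qed.

Lemma vertex_dot_inj w x y : vertices P w -> P x -> P y ->
  (forall i, i \in inc w -> dot x (a i) = dot y (a i)) -> x = y.
Proof.
move=> vw Px Py h; apply/eqP; rewrite -subr_eq0; apply/eqP.
apply: (vertex_kernel vw (P_subU Px Py)) => i /h e.
by rewrite dotBl e subrr.
Qed.

Lemma common_kernel (A : {set 'I_n}) : (#|A| < d)%N ->
  exists y, [/\ y \in U, y != 0 & forall i, i \in A -> dot y (a i) = 0].
Proof.
move=> Ad; pose M := \matrix_(r < m, j < #|A|) a (enum_val j) r 0.
pose f : 'Hom('rV[R]_m, 'rV[R]_#|A|) := linfun (mulmxr M).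
have : (0 < \dim (U :&: lker f))%N.
  have := limg_ker_dim f U; have := dimvS (subvf (f @: U)%VS).
  rewrite dimvf /dim /= mul1n dimU => h1 h2; rewrite lt0n; apply: contraTN Ad => /eqP h3.
  by rewrite -leqNgt -h2 h3.
rewrite lt0n dimv_eq0 => /eqP/eqP h; exists (vpick (U :&: lker f)).
have := memv_pick (U :&: lker f)%VS; rewrite memv_cap memv_ker lfunE /= => /andP[-> /eqP k].
split=> //; first by rewrite vpick0.
move=> i iA; move/rowP: k => /(_ (enum_rank_in iA i)); rewrite !mxE => <-.
by rewrite /dot mxE; apply: eq_bigr => r _; rewrite !mxE enum_rankK_in.
Qed.

Hypothesis simpleP : forall v, vertices P v -> #|inc v| = d.

(** For a dimension reason there is a direction [z] along which only the
    functional of the facet [i] is nonzero, say negative. If all generators other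
    than [w] violated one of the equations of the remaining facets, the sum [c] of
    their functionals would be strictly negative on them, hence [M c - a i] would
    still be valid for large [M] and positive on [z]. Then some facet functional
    would be positive on [z], contrary to the choice of [z]. *)
Lemma edge_gen w i : vertices P w -> i \in inc w ->
  exists2 x, x \in s & x != w /\ inc w :\ i \subset inc x.
Proof.
move=> vw iw; have [Pw ws _] := vertexE vw.
apply: contrapT => /forall2NP h.
set J := inc w :\ i.
have JI : J \subset inc w by rewrite finset.subDset finset.subsetUr.
have [|y [yU y0 yJ]] := @common_kernel J.
  by rewrite -(simpleP vw) (cardsD1 i (inc w)) iw.
have [z [zU zi zJ]] : exists z, [/\ z \in U, dot z (a i) < 0 &
    forall j, j \in J -> dot z (a j) = 0].
  have yi : dot y (a i) != 0.
    apply: contra_neq y0 => yi; apply: (vertex_kernel vw yU) => j jw.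
    by have [->//|ji] := eqVneq j i; apply: yJ; rewrite /J finset.in_setD1 ji.
  case: (ltgtP (dot y (a i)) 0) yi => // yi _; first by exists y.
  exists (- 1 *: y); split; first by rewrite memvZ.
    by rewrite dotZl mulN1r oppr_lt0.
  by move=> j jJ; rewrite dotZl yJ ?mulr0.
pose c := \sum_(j in J) a j.
have [x xs xw|M M0 hM] := @dominate (fun x => x != w) (fun x => dot (x - w) c)
    (fun x => dot (x - w) (- a i)).
  have Px := gen_P xs.
  rewrite lt_neqAle valid_sum // andbT dotBl subr_eq0; apply/eqP.
  have [/= + _] := sum_facet_eq J Px.
  have [_ /(_ JI) ->] := sum_facet_eq J Pw => /[apply] Jx.
  by case: (h x) => // -[]; split.
have vM : valid w (M *: c - a i).
  move=> x xs; rewrite dotDr dotZr.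
  by have [->|/(hM x xs)/ltW//] := eqVneq x w; rewrite subrr !dot0l mulr0 addr0.
have [|l lw] := facet_separates_inc Pw zU vM.
  by rewrite dotDr dotZr dot_sumr big1 // mulr0 add0r dotNr oppr_gt0.
have [->|li] := eqVneq l i; first by rewrite ltNge (ltW zi).
by rewrite zJ ?ltxx // /J finset.in_setD1 li.
Qed.

(** Among the generators on the edge, the one farthest from the facet [i] is the
    other end. *)
Lemma edge_vertex w i : vertices P w -> i \in inc w ->
  exists v, [/\ vertices P v, v != w & inc w :\ i \subset inc v].
Proof.
move=> vw iw; have [Pw ws _] := vertexE vw.
have [x xs [xw xJ]] := edge_gen vw iw.
set J := inc w :\ i in xJ *.
have JI : J \subset inc w by rewrite finset.subDset finset.subsetUr.
have hs : has (fun x => J \subset inc x) s by apply/hasP; exists x.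
have [v [vs vJ vmin]] := seq_argmin (fun x => dot x (a i)) hs.
have Pv := gen_P vs; have Px := gen_P xs.
have dotJ y z : P y -> P z -> J \subset inc y -> J \subset inc z ->
    dot y (a i) = dot z (a i) -> y = z.
  move=> Py Pz /fintype.subsetP yJ /fintype.subsetP zJ e; apply: (vertex_dot_inj vw) => // j jw.
  have [->//|ji] := eqVneq j i; have jJ : j \in J by rewrite /J finset.in_setD1 ji.
  by have := yJ _ jJ; have := zJ _ jJ; rewrite !inc_dot // => /eqP-> /eqP->.
exists v; split=> //; last first.
  apply: contra_neq xw => e; apply: dotJ => //; apply/eqP; rewrite eq_le -{2}e vmin // andbT.
  by have := iw; rewrite inc_dot // => /eqP->; exact: Fle.
have [va _] := sum_facet_eq J Pv.
apply: (@face_vertexI v (\sum_(j in J) a j) (\sum_(j in J) b j) (- a i)) => //.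
- by move=> z; exact: sum_facet_le.
- exact/sum_facet_eq.
move=> z zs /sum_facet_eq zJ zv; rewrite !dotNr ltrN2 lt_neqAle vmin ?andbT //.
  by apply: contra_neq zv => /esym; apply: dotJ => //; [exact: gen_P|apply: zJ; exact: gen_P].
by apply: zJ; exact: gen_P.
Qed.

Variable nb : 'rV[R]_m -> 'I_n -> 'rV[R]_m.
Hypothesis nbP : forall w i, vertices P w -> i \in inc w ->
  [/\ vertices P (nb w i), nb w i != w & inc w :\ i \subset inc (nb w i)].

Lemma nb_dot w i j : vertices P w -> i \in inc w -> j \in inc w -> j != i ->
  dot (nb w i - w) (a j) = 0.
Proof.
move=> vw iw jw ji; have [vn _ /fintype.subsetP/(_ j)] := nbP vw iw.
have [Pw _ _] := vertexE vw; have [Pn _ _] := vertexE vn.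
rewrite finset.in_setD1 ji jw => /(_ isT); move: jw.
by rewrite !inc_dot // dotBl => /eqP-> /eqP->; rewrite subrr.
Qed.

Lemma nb_dot_lt w i : vertices P w -> i \in inc w -> dot (nb w i - w) (a i) < 0.
Proof.
move=> vw iw; have [vn nw _] := nbP vw iw.
have [Pw _ _] := vertexE vw; have [Pn _ _] := vertexE vn.
move: (iw); rewrite inc_dot // dotBl subr_lt0 => /eqP iE.
rewrite iE lt_neqAle Fle // andbT; apply: contra_neq nw => e.
apply: (vertex_dot_inj vw) => // j jw.
have [->|ji] := eqVneq j i; first by rewrite iE.
by apply/eqP; rewrite -subr_eq0 -dotBl nb_dot.
Qed.

(** The coordinates of [x - w] in the basis of edge directions at [w], read off
    with the facet functionals, which form the dual basis up to scaling. *)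
Definition edge_coord w x i : R := dot (x - w) (a i) / dot (nb w i - w) (a i).

Lemma edge_coord_ge0 w x i : vertices P w -> P x -> i \in inc w -> 0 <= edge_coord w x i.
Proof.
move=> vw Px iw; have [Pw _ _] := vertexE vw.
rewrite /edge_coord ler_ndivlMr ?nb_dot_lt // mul0r dotBl subr_le0.
by move: iw; rewrite inc_dot // => /eqP->; exact: Fle.
Qed.

Lemma edge_coord_eq0 w x i : vertices P w -> P x -> i \in inc w -> i \in inc x ->
  edge_coord w x i = 0.
Proof.
move=> vw Px; have [Pw _ _] := vertexE vw; rewrite !inc_dot // => /eqP iw /eqP ix.
by rewrite /edge_coord dotBl iw ix subrr mul0r.
Qed.

Lemma edge_coordE w x : vertices P w -> P x ->
  x - w = \sum_(i in inc w) edge_coord w x i *: (nb w i - w).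
Proof.
move=> vw Px; have [Pw _ _] := vertexE vw.
apply/eqP; rewrite -subr_eq0; apply/eqP/(vertex_kernel vw) => [|j jw].
  rewrite rpredB ?P_subU //; apply: memv_suml => i iw; rewrite memvZ // P_subU //.
  by have [/vertexE[]] := nbP vw iw.
rewrite dotBl dot_suml (bigD1 j) //= dotZl divfK ?lt_eqF ?nb_dot_lt //.
by rewrite big1 ?addr0 ?subrr // => i /andP[iw ij]; rewrite dotZl nb_dot ?mulr0 // eq_sym.
Qed.

(** Points of the edge are [w + t (nb w i - w)]; both ends are vertices and a third
    vertex with [0 < t < 1] or [1 < t] would contradict the functional that
    exposes it, or the one that exposes [nb w i]. *)
Lemma edge_unique w i u : vertices P w -> i \in inc w -> vertices P u ->
  inc w :\ i \subset inc u -> u = w \/ u = nb w i.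
Proof.
move=> vw iw vu /fintype.subsetP wu.
have [Pu _ [cu cuP]] := vertexE vu; have [Pw _ _] := vertexE vw.
have [vn nw _] := nbP vw iw; have [Pn _ [cn cnP]] := vertexE vn.
set t := edge_coord w u i.
have uE : u - w = t *: (nb w i - w).
  rewrite (edge_coordE vw Pu) (bigD1 i) //= big1 ?addr0 // => j /andP[jw ji].
  by rewrite edge_coord_eq0 ?scale0r //; apply: wu; rewrite finset.in_setD1 ji.
have [t0|t0] := eqVneq t 0; first by left; apply/eqP; rewrite -subr_eq0 uE t0 scale0r.
have [t1|t1] := eqVneq t 1.
  right; apply/eqP; rewrite -(inj_eq (addIr (- w))) uE t1 scale1r //.
have t_gt0 : 0 < t by rewrite lt_neqAle eq_sym t0 edge_coord_ge0.
have uw : u != w.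
  by rewrite -subr_eq0 uE scaler_eq0 (negbTE t0) subr_eq0.
have un : u != nb w i.
  rewrite -(inj_eq (addIr (- w))) uE -subr_eq0 -{2}[nb w i - w]scale1r -scalerBl.
  by rewrite scaler_eq0 !subr_eq0 (negbTE t1) (negbTE nw).
have uc c : dot u c - dot w c = t * (dot (nb w i) c - dot w c).
  by rewrite -!dotBl uE dotZl.
have wn : w != nb w i by rewrite eq_sym.
have wu' : w != u by rewrite eq_sym.
have nu : nb w i != u by rewrite eq_sym.
have h1 := cnP _ Pu un; have h2 := cnP _ Pw wn; have h3 := uc cn.
have h4 := cuP _ Pn nu; have h5 := cuP _ Pw wu'; have h6 := uc cu.
exfalso; clearbody t; move: t_gt0 h1 h2 h3 h4 h5 h6; clear.
move: (dot u cn) (dot w cn) (dot (nb w i) cn) (dot u cu) (dot w cu) (dot (nb w i) cu).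
move: t => t' u1 w1 n1 u2 w2 n2 t_gt0 h1 h2 h3 h4 h5 h6.
have g1 : 0 < n1 - w1 by lra.
have g2 : 0 < n2 - w2 by rewrite -(pmulr_rgt0 _ t_gt0) -h6; lra.
have l1 : t' < 1 by rewrite -(ltr_pM2r g1) mul1r -h3; lra.
have l2 : 1 < t' by rewrite -(ltr_pM2r g2) mul1r -h6; lra.
by have := lt_trans l1 l2; rewrite ltxx.
Qed.

(** A face lies in the cone spanned at [w] by its edges. *)
Lemma edges_up_min phi w (J : {set 'I_n}) x : vertices P w ->
  (forall i, i \in inc w :\: J -> dot w phi <= dot (nb w i) phi) ->
  P x -> J \subset inc x -> dot w phi <= dot x phi.
Proof.
move=> vw up Px /fintype.subsetP Jx.
rewrite -subr_ge0 -dotBl (edge_coordE vw Px) dot_suml sumr_ge0 // => i iw.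
have [iJ|iJ] := boolP (i \in J); first by rewrite edge_coord_eq0 ?scale0r ?dot0l // Jx.
rewrite dotZl mulr_ge0 ?edge_coord_ge0 // dotBl subr_ge0 up //.
by rewrite finset.in_setD iJ.
Qed.

Lemma two_face_dim w k l : vertices P w -> k \in inc w -> l \in inc w -> k != l ->
  has_dim [set x | P x /\ dot x (\sum_(j in inc w :\ k :\ l) a j)
    = \sum_(j in inc w :\ k :\ l) b j]%classic 2.
Proof.
move=> vw kw lw kl; set K := inc w :\ k :\ l; set Q := [set x | _]%classic.
have [Pw _ _] := vertexE vw.
have QP x : Q x <-> P x /\ K \subset inc x.
  by split=> -[Px /(sum_facet_eq K Px)].
have Kw : K \subset inc w by apply/fintype.subsetP => x; rewrite !finset.in_setD1 => /and3P[].
have Qn i : i \in inc w -> i \in [:: k; l] -> Q (nb w i).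
  move=> iw ikl; have [/vertexE[Pn _ _] _ wn] := nbP vw iw.
  apply/QP; split=> //; apply: fintype.subset_trans wn.
  apply/fintype.subsetP => j; rewrite !finset.in_setD1 => /and3P[jl jk ->]; rewrite andbT.
  by apply: contraNneq jk => ji; move: ikl; rewrite -ji !inE (negbTE jl) orbF.
exists w, <<[seq x - w | x <- [:: nb w k; nb w l]]>>%VS; split; last first.
  apply: (@aff_hullE _ _ [:: nb w k; nb w l]) => // [|x|x].
  - exact/QP.
  - by rewrite !inE => /orP[] /eqP->; apply: Qn => //; rewrite !inE eqxx ?orbT.
  move=> /QP[Px /fintype.subsetP Kx]; rewrite (edge_coordE vw Px).
  apply: memv_suml => i iw; have [iK|] := boolP (i \in K).
    by rewrite (edge_coord_eq0 vw Px iw (Kx _ iK)) scale0r mem0v.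
  rewrite !finset.in_setD1 iw andbT negb_and !negbK => ikl; apply/memvZ/memv_span.
  by case/orP: ikl => /eqP->; rewrite !inE eqxx ?orbT.
have nbk : dot (nb w k - w) (a k) != 0 by rewrite lt_eqF ?nb_dot_lt.
have nbl : nb w l - w != 0 by have [_ h _] := nbP vw lw; rewrite subr_eq0.
suff /eqP : free [:: nb w k - w; nb w l - w] by [].
rewrite free_cons seq1_free nbl andbT span_seq1; apply/negP => /vlineP[r rE].
by move: nbk; rewrite rE dotZl nb_dot ?mulr0 ?eqxx // eq_sym.
Qed.

End Facets.
End Polytope.
End Geometry.

(** * Facet colourings of even simple polytopes *)
Section GenericFunctional.
Local Open Scope ring_scope.

Lemma exists_nonroot (K : numDomainType) (p : {poly K}) :
  p != 0 -> exists k : nat, p.[k%:R] != 0.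
Proof.
move=> p0; pose rs : seq K := [seq k%:R | k <- iota 0 (size p)].
have urs : uniq rs by rewrite map_inj_uniq ?iota_uniq //; exact: mulrIn (oner_neq0 K).
apply: contrapT => h; have rsp : all (root p) rs.
  apply/allP => _ /mapP[k _ ->]; apply: contrapT => hk; apply: h; exists k.
  exact/negP.
by have := max_poly_roots p0 rsp urs; rewrite size_map size_iota ltnn.
Qed.

(** On the moment curve: for distinct [x] and [y], the value of [x - y] at
    [(1, t, t ^ 2, ...)] is a nonzero polynomial in [t]. *)
Lemma exists_generic_functional {R : realType} {m : nat} (s : seq 'rV[R]_m) :
  exists phi, {in s &, injective (fun x => dot x phi)}.
Proof.
pose p := \prod_(x <- s) \prod_(y <- s | x != y) rVpoly (x - y).
have [|k pk] := @exists_nonroot _ p.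
  rewrite prodf_seq_neq0; apply/allP => x _; rewrite prodf_seq_neq0; apply/allP => y _.
  apply/implyP => xy; apply: contra_neq xy => e; apply/eqP.
  by rewrite -subr_eq0 -(rVpolyK (x - y)) e linear0.
exists (\col_j k%:R ^+ j) => x y xs ys /= e; apply: contrapT => /eqP xy.
have dotE (z : 'rV[R]_m) : dot z (\col_j k%:R ^+ j) = (rVpoly z).[k%:R].
  rewrite /dot mxE /rVpoly horner_poly; apply: eq_bigr => j _.
  by rewrite mxE insubT //= => ?; congr (z _ _ * _); apply: val_inj.
move: pk; rewrite horner_prod; apply/negP; rewrite negbK prodf_seq_eq0.
apply/hasP; exists x => //=; rewrite horner_prod prodf_seq_eq0; apply/hasP; exists y => //=.
by rewrite xy -dotE dotBl e subrr eqxx.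
Qed.


End GenericFunctional.

Lemma card_image_finset (T : finType) (V : Type) (f : T -> V) (B : {set T}) :
  injective f -> (f @` [set x | x \in B] #= `I_#|B|)%classic%card.
Proof.
move=> f_inj; apply: card_eq_trans (inj_card_eq (in2W f_inj)) _.
have -> : [set x | x \in B]%classic = ((fun k : 'I_#|B| => enum_val k) @` [set: _])%classic.
  apply/seteqP; split=> [x xB|_ [k _ <-]]; last exact: enum_valP.
  by exists (enum_rank_in xB x) => //; rewrite enum_rankK_in.
apply: card_eq_trans (inj_card_eq (in2W enum_val_inj)) _.
by rewrite card_eq_sym; exact: card_II.
Qed.

Section SimplePolytope.
Local Open Scope ring_scope.
Context {R : realType} {m n d : nat}.
Variables (P : set 'rV[R]_m) (F : 'I_n -> set 'rV[R]_m).
Hypothesis d_gt0 : (0 < d)%N.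
Hypothesis simpleP : simple_polytope d P.
Hypothesis F_inj : injective F.
Hypothesis facetF : forall A, facet P A <-> exists i, F i = A.

Lemma card_vertex_inc v : vertices P v -> #|inc F v| = d.
Proof.
have [_ _ /(_ v)] := simpleP => /[apply] h.
apply/card_eq_II; apply: card_eq_trans h; rewrite card_eq_sym.
suff -> : [set A | facet P A /\ A v]%classic = (F @` [set i | i \in inc F v])%classic.
  exact: card_image_finset.
apply/seteqP; split=> [A [/facetF[i <-] Fv]|_ [i /incP Fv <-]].
  by exists i => //; apply/incP.
by split=> //; apply/facetF; exists i.
Qed.

Lemma simple_has_vertex : exists2 v, vertices P v & P v.
Proof.
have [[X /finite_seqP[s ->] PE] [x0 [U [dimU affP]]] _] := simpleP.
have [phi phi_inj] := exists_generic_functional s.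
have [||v vv _] := @face_min_vertex _ _ P s PE phi 0 0 phi_inj.
- by move=> x _; rewrite dot0r.
- have : aff_hull P x0 by rewrite affP /= subrr mem0v.
  case=> -[|k] [p [c [Pp c1 _]]]; last by exists (p ord0); rewrite ?dot0r.
  by move: c1; rewrite big_ord0 => /eqP; rewrite eq_sym oner_eq0.
by exists v => //; have [] := vertexE PE vv.
Qed.

Hypothesis evenP : even_polytope P.

(** The vertices, sorted by a generic functional, satisfy the hypotheses of the
    sweep. Its conclusion concerns facets with a common vertex; facets with a
    common point [x] meet in a nonempty face, which has a vertex. *)
Lemma simple_even_coloring : exists col : 'I_n -> 'I_d,
  forall x i j, P x -> F i x -> F j x -> col i = col j -> i = j.
Proof.
have [[X /finite_seqP[s ->] PE] [x0 [U [dimU affP]]] _] := simpleP.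
have [phi phi_inj] := exists_generic_functional s.
have /choice[ab abP] i : exists ab : 'cV[R]_m * R, (forall x, P x -> dot x ab.1 <= ab.2) /\
    F i = [set x | P x /\ dot x ab.1 = ab.2]%classic.
  have [[a [b [h1 h2]]] _] : facet P (F i) by apply/facetF; exists i.
  by exists (a, b).
pose a i := (ab i).1; pose b i := (ab i).2.
have Fle i x : P x -> dot x (a i) <= b i by case: (abP i) => h _; exact: h.
have FE i : F i = [set x | P x /\ dot x (a i) = b i]%classic by case: (abP i).
have fF A : facet P A -> exists i, F i = A by move=> /facetF.
have /choice[nb' nbP'] : forall wi : 'rV[R]_m * 'I_n, exists v,
    vertices P wi.1 -> wi.2 \in inc F wi.1 ->
    [/\ vertices P v, v != wi.1 & inc F wi.1 :\ wi.2 \subset inc F v].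
  move=> [w i]; have [[vw iw]|h] := pselect (vertices P w /\ i \in inc F w).
    have [v h] := edge_vertex PE dimU affP fF Fle FE card_vertex_inc vw iw.
    by exists v.
  by exists 0 => vw iw; case: h.
pose nb w i := nb' (w, i).
have nbP w i : vertices P w -> i \in inc F w ->
  [/\ vertices P (nb w i), nb w i != w & inc F w :\ i \subset inc F (nb w i)] := nbP' (w, i).
pose leq_phi x y := dot x phi <= dot y phi.
pose vs := sort leq_phi (undup [seq x <- s | `[< vertices P x >]]).
have vsP x : reflect (vertices P x) (x \in vs).
  rewrite mem_sort mem_undup mem_filter; apply: (iffP andP) => [[/asboolP]//|vx].
  by have [_ xs _] := vertexE PE vx; split=> //; apply/asboolP.
have vs_uniq : uniq vs by rewrite sort_uniq undup_uniq.
have vs_s : {subset vs <= s} by move=> x /vsP/(vertexE PE)[].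
have vs_sorted : sorted leq_phi vs by apply: sort_sorted => x y; exact: le_total.
pose pt (v : 'I_(size vs)) := nth 0 vs v.
have ptV v : vertices P (pt v) by apply/vsP; rewrite mem_nth.
have ptP v : P (pt v) by have [] := vertexE PE (ptV v).
have pt_inj : injective pt.
  by move=> u v /eqP; rewrite nth_uniq // => /eqP/val_inj.
have pt_mono (u v : 'I_(size vs)) : (u <= v)%N = (dot (pt u) phi <= dot (pt v) phi).
  have mono (i j : 'I_(size vs)) : (i <= j)%N -> leq_phi (pt i) (pt j).
    have leT : transitive leq_phi by move=> x y z; exact: le_trans.
    have leR : reflexive leq_phi by move=> x; exact: lexx.
    by move=> ij; apply: (sorted_leq_nth leT leR) => //; rewrite inE.
  apply/idP/idP => [|uv]; first exact: mono.
  rewrite leqNgt; apply/negP => vu; have := mono _ _ (ltnW vu); rewrite /leq_phi => vu'.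
  have /pt_inj e : pt u = pt v.
    by apply: phi_inj; rewrite ?vs_s ?mem_nth //; apply/eqP; rewrite eq_le uv.
  by rewrite e ltnn in vu.
pose nbI v i : 'I_(size vs) := insubd v (index (nb (pt v) i) vs).
have pt_nb v i : i \in inc F (pt v) -> pt (nbI v i) = nb (pt v) i.
  move=> iv; have [/vsP nv _ _] := nbP _ _ (ptV v) iv.
  rewrite /pt /nbI insubdK ?nth_index //.
  by rewrite unfold_in index_mem.
have [|v i iv|v i u iv|v J Jv up u Ju|v J Jv up u Ju|v k l kv lv kl|col colP] :=
  @facet_coloring n d (size vs) (fun v => inc F (pt v)) nbI d_gt0.
- by move=> v; exact: card_vertex_inc.
- have [_ nv _] := nbP _ _ (ptV v) iv.
  by apply: contra_neq nv => e; rewrite -pt_nb // e.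
- have [_ _ vn] := nbP _ _ (ptV v) iv.
  apply/idP/orP => [h|[]/eqP->]; last 2 first.
  + by rewrite finset.subD1set.
  + by rewrite pt_nb.
  have := edge_unique PE dimU affP fF Fle FE nbP (ptV v) iv (ptV u) h.
  by rewrite -pt_nb // => -[] /pt_inj ->; rewrite eqxx; [left|right].
- rewrite pt_mono.
  apply: (edges_up_min PE dimU affP fF Fle FE nbP (ptV v) _ (ptP u) Ju) => i.
  move=> iJ; have iv : i \in inc F (pt v) by move: iJ; rewrite finset.in_setD => /andP[].
  by have := ltnW (up i iJ); rewrite pt_mono pt_nb.
- rewrite pt_mono -lerN2 -!dotNr.
  apply: (edges_up_min PE dimU affP fF Fle FE nbP (ptV v) _ (ptP u) Ju) => i.
  move=> iJ; have iv : i \in inc F (pt v) by move: iJ; rewrite finset.in_setD => /andP[].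
  by have := ltnW (up i iJ); rewrite pt_mono pt_nb // !dotNr lerN2.
- have := two_face_dim PE dimU affP fF Fle FE nbP (ptV v) kv lv kl.
  set K := inc F (pt v) :\ k :\ l; set Q := [set x | _]%classic => dimQ.
  have Qle := sum_facet_le Fle K.
  have faceQ : face P Q by exists (\sum_(j in K) a j), (\sum_(j in K) b j).
  have [h hE] := evenP faceQ dimQ.
  set B := [set u | K \subset inc F (pt u)]%SET; suff -> : #|B| = h.*2 by rewrite odd_double.
  apply/card_eq_II; apply: card_eq_trans hE; rewrite card_eq_sym.
  suff -> : vertices Q = (pt @` [set u | u \in B])%classic.
    exact: card_image_finset.
  rewrite (face_vertices PE Qle); apply/seteqP; split=> [x [vx [Px]]|_ [u + <-]].
    move=> /(sum_facet_eq Fle FE K Px) Kx; have xvs : x \in vs by exact/vsP.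
    have xi : (index x vs < size vs)%N by rewrite index_mem.
    have ptx : pt (Ordinal xi) = x by rewrite /pt /= nth_index.
    by exists (Ordinal xi); rewrite //= inE ptx.
  rewrite /= inE => Ku; split; first exact: ptV.
  by split; [exact: ptP|apply/(sum_facet_eq Fle FE K)].
exists col => x i j Px Fi Fj cij.
have ij : [set i; j]%SET \subset inc F x.
  by rewrite finset.subUset !finset.sub1set; apply/andP; split; apply/incP.
have [v vv] := face_min_vertex PE phi_inj (sum_facet_le Fle [set i; j]%SET)
  (ex_intro2 _ _ x Px ((sum_facet_eq Fle FE _ Px).2 ij)).
have [Pv _ _] := vertexE PE vv.
move=> /(sum_facet_eq Fle FE _ Pv); rewrite finset.subUset !finset.sub1set => /andP[iv jv].
have /vsP xvs := vv.
have xi : (index v vs < size vs)%N by rewrite index_mem.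
have ptx : pt (Ordinal xi) = v by rewrite /pt /= nth_index.
by apply: (colP (Ordinal xi)); rewrite ?ptx.
Qed.

End SimplePolytope.

(** * Lattices with trivial orthogonal complement *)
Section IntegerSpan.
Local Open Scope ring_scope.

Lemma common_denominator (I : finType) (f : I -> rat) :
  exists D : nat, (0 < D)%N /\ exists w : I -> int, forall i, (w i)%:~R = D%:R * f i.
Proof.
exists (\prod_i `|denq (f i)|)%N; split.
  by apply: prodn_gt0 => i; rewrite absz_gt0 denq_neq0.
exists (fun i => numq (f i) * \prod_(j | j != i) denq (f j)) => i.
have -> : (\prod_j `|denq (f j)|)%N%:R = \prod_j (denq (f j))%:~R :> rat.
  by rewrite natr_prod; apply: eq_bigr => j _; rewrite natr_absz ger0_norm.
rewrite [in RHS](bigD1 i) //= intrM rmorph_prod /= numqE; ring.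
Qed.

Variable k : nat.
Definition ratrow (z : 'I_k -> int) : 'rV[rat]_k := \row_i (z i)%:~R.

(** Vectors are added to the list as long as the dimension of its span grows. *)
Lemma finite_rational_generators (S : ('I_k -> int) -> Prop) :
  exists l : seq ('I_k -> int), (forall z, z \in l -> S z) /\
    forall z, S z -> ratrow z \in <<map ratrow l>>%VS.
Proof.
pose dimg (l : seq ('I_k -> int)) := \dim <<map ratrow l>>.
suff H e l : (forall z, z \in l -> S z) -> (k <= e + dimg l)%N ->
    exists l : seq ('I_k -> int), (forall z, z \in l -> S z) /\
      forall z, S z -> ratrow z \in <<map ratrow l>>%VS.
  by apply: (H k [::]) => //; rewrite leq_addr.
elim: e l => [|e IH] l lS kl.
  exists l; split=> // z _.
  have /eqP-> : <<map ratrow l>>%VS == fullv by rewrite eqEdim subvf dimvf /dim /= mul1n.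
  exact: memvf.
have [h|/existsNP[z /not_implyP[Sz zl]]] := pselect (forall z, S z -> ratrow z \in <<map ratrow l>>%VS).
  by exists l.
apply: (IH (z :: l)) => [y|]; first by rewrite inE => /predU1P[->//|]; exact: lS.
rewrite (leq_trans kl) // addSnnS leq_add2l /dimg /= span_cons addvC dim_add_line //.
exact/negP.
Qed.

(** A group of integer vectors whose rational span is a proper subspace is
    orthogonal to a nonzero rational, hence integer, vector. So the span is
    everything, and clearing denominators puts a multiple of each unit vector in
    the group. *)
Lemma full_rank_of_perp (S : ('I_k -> int) -> Prop) :
  S (fun=> 0) -> (forall y z, S y -> S z -> S (fun i => y i - z i)) ->
  (forall w : 'I_k -> int, (forall z, S z -> \sum_i z i * w i = 0) -> forall i, w i = 0) ->
  exists2 D : nat, (0 < D)%N & forall i, S (fun j => if j == i then Posz D else 0).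
Proof.
move=> S0 SB perp; have [l [lS gen]] := finite_rational_generators S.
have SD y z : S y -> S z -> S (fun i => y i + z i).
  move=> Sy Sz; have := SB _ _ Sy (SB _ _ S0 Sz).
  by congr S; apply/funext => i; rewrite sub0r opprK.
have SN z : S z -> S (fun i => - z i).
  by move=> Sz; have := SB _ _ S0 Sz; congr S; apply/funext => i; rewrite sub0r.
have SMn z (e : nat) : S z -> S (fun i => z i *+ e).
  by move=> Sz; elim: e => [|e IH] //; have := SD _ _ Sz IH; congr S; apply/funext => i; rewrite mulrS.
have SM z (e : int) : S z -> S (fun i => e * z i).
  case: e => e Sz; first by have := SMn _ e Sz; congr S; apply/funext => i; rewrite -mulr_natl natz.
  have := SN _ (SMn _ e.+1 Sz); congr S; apply/funext => i.
  by rewrite NegzE mulNr -mulr_natl natz.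
have full : <<map ratrow l>>%VS = fullv.
  apply/eqP; rewrite eqEsubv subvf /=; apply/subvP => u _; apply: contrapT => /negP.
  case/separate_subspace => a ha /eqP; apply.
  have [D [D0 [w wE]]] := common_denominator (fun i => a i 0).
  have w0 : forall i, w i = 0.
    apply: perp => z /gen/ha /(congr1 ( *%R D%:R)); rewrite mulr0 /dot mxE mulr_sumr => e.
    apply: (@intr_inj rat); rewrite rmorph_sum /= -[RHS]e; apply: eq_bigr => i _.
    by rewrite rmorphM /= wE mxE mulrCA.
  rewrite /dot mxE big1 // => i _; suff -> : a i 0 = 0 by rewrite mulr0.
  have := wE i; rewrite w0 => /esym/eqP; rewrite mulf_eq0 pnatr_eq0 eqn0Ngt D0 => /eqP //.
pose l' := in_tuple (map ratrow l).
pose cf (p : 'I_k * 'I_(size (map ratrow l))) : rat := coord l' p.2 (delta_mx 0 p.1).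
have [D [D0 [w wE]]] := common_denominator cf.
have Ssum (J : Type) (r : seq J) (G : J -> 'I_k -> int) :
    (forall j, S (G j)) -> S (fun i => \sum_(j <- r) G j i).
  move=> SG; elim: r => [|j r IH].
    by congr S: S0; apply/funext => i; rewrite big_nil.
  by have := SD _ _ (SG j) IH; congr S; apply/funext => i; rewrite big_cons.
exists D => // i.
have := @Ssum _ (index_enum _) (fun (e : 'I_(size (map ratrow l))) j => w (i, e) * nth (fun=> 0) l e j).
have lt_l (e : 'I_(size (map ratrow l))) : (e < size l)%N.
  by have := ltn_ord e; move: (e : nat) => e'; rewrite size_map.
move=> /(_ (fun e => SM _ _ (lS _ (mem_nth _ (lt_l e))))); congr S; apply/funext => j.
apply: (@intr_inj rat); rewrite rmorph_sum /=.
have : delta_mx 0 i \in <<map ratrow l>>%VS by rewrite full memvf.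
move=> /(@coord_span _ _ _ l') /(congr1 (fun u : 'rV[rat]_k => D%:R * u 0 j)).
rewrite mxE eqxx /= summxE mulr_sumr => e; transitivity (D%:R * (j == i)%:R : rat); last first.
  by case: eqP; rewrite ?mulr1 ?mulr0.
rewrite e; apply: eq_bigr => x _; rewrite rmorphM /= wE mxE mulrA; congr (_ * _).
by rewrite (nth_map (fun=> 0)) ?mxE.
Qed.

End IntegerSpan.

(** * Characters and closed subgroups of the torus *)
Section Characters.
Local Open Scope ring_scope.
Context {R : realType} {n : nat}.
Local Notation K := R[i].
Implicit Types (t g : torus R n) (G : set (torus R n)) (z w : 'I_n -> int).

Definition character z t : K := \prod_i t i ^ z i.
Definition expo (m : 'X_{1..n}) : 'I_n -> int := fun i => Posz (m i).

Lemma character_neq0 z t : character z t != 0.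
Proof. by apply/prodf_neq0 => i _; rewrite expfz_neq0 ?torus_neq0. Qed.

Lemma characterD z w t : character (fun i => z i + w i) t = character z t * character w t.
Proof.
by rewrite -big_split /=; apply: eq_bigr => i _; rewrite expfzDr ?torus_neq0.
Qed.

Lemma characterN z t : character (fun i => - z i) t = (character z t)^-1.
Proof. by rewrite -prodfV; apply: eq_bigr => i _; rewrite -invr_expz. Qed.

Lemma character0 t : character (fun=> 0) t = 1.
Proof. by rewrite /character big1. Qed.

Lemma characterM z s t : character z (s * t)%g = character z s * character z t.
Proof.
by rewrite -big_split /=; apply: eq_bigr => i _; rewrite torusME expfzMl.
Qed.

Lemma character1 z : character z (1%g : torus R n) = 1.
Proof. by rewrite /character big1 // => i _; rewrite torus1E exp1rz. Qed.

Lemma characterX z t k : character z (t ^+ k)%g = character z t ^+ k.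
Proof.
elim: k => [|k IH]; first by rewrite expg0 character1 expr0.
by rewrite expgS characterM IH exprS.
Qed.

Lemma meval_character (p : {mpoly K[n]}) t :
  p.@[t] = \sum_(m <- msupp p) p@_m * character (expo m) t.
Proof. exact: mevalE. Qed.

Definition trivial_on G z := forall g, G g -> character z g = 1.

Lemma trivial_onB G z w : trivial_on G z -> trivial_on G w ->
  trivial_on G (fun i => z i - w i).
Proof. by move=> hz hw g Gg; rewrite characterD characterN hz // hw // invr1 mulr1. Qed.

Lemma trivial_onP G z w : trivial_on G (fun i => z i - w i) <->
  forall g, G g -> character z g = character w g.
Proof.
split=> h g Gg; have := h g Gg; rewrite characterD characterN; first exact: divr1_eq.
by move->; rewrite divff ?character_neq0.
Qed.

Section Subgroup.
Variable G : set (torus R n).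
Hypothesis G1 : G 1%g.
Hypothesis GM : forall s t, G s -> G t -> G (s * t)%g.

Lemma GX t k : G t -> G (t ^+ k)%g.
Proof. by move=> Gt; elim: k => [|k IH]; rewrite ?expg0 ?expgS //; exact: GM. Qed.

(** A linear relation between monomials on the subgroup [G] is a sum of relations
    between monomials that agree on [G], so it persists at every [t] at which the
    characters trivial on [G] are trivial. If two of the monomials differ at
    [h1], translating the relation by the powers of [h1] multiplies each monomial
    by powers of its value at [h1]; with a polynomial [pi] in these values, the
    terms with the same value as [m0] are split off, and both parts are shorter. *)
Lemma relation_on_characters t (r : seq 'X_{1..n}) (c : 'X_{1..n} -> K) :
  (forall z, trivial_on G z -> character z t = 1) ->
  (forall g, G g -> \sum_(m <- r) c m * character (expo m) g = 0) ->
  \sum_(m <- r) c m * character (expo m) t = 0.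
Proof.
move=> tG; have [k] := ubnP (size r); elim: k r => // k IH [|m0 r'].
  by rewrite big_nil.
set r := m0 :: r'; rewrite ltnS => rk h.
have [same|] := pselect (forall m g, m \in r -> G g ->
    character (expo m) g = character (expo m0) g).
  have E m : m \in r -> character (expo m) t = character (expo m0) t.
    move=> mr; apply: divr1_eq; rewrite -characterN -characterD; apply: tG.
    by apply/trivial_onP => g; exact: same.
  rewrite (eq_big_seq (fun m => c m * character (expo m0) t)) => [|m mr]; last by rewrite E.
  rewrite -mulr_suml; have := h _ G1.
  under eq_bigr do rewrite character1 mulr1.
  by move->; rewrite mul0r.
move=> /existsNP[m1 /existsNP[h1 /not_implyP[m1r /not_implyP[Gh1 /eqP ne]]]].
pose X m := character (expo m) h1.
pose Q m := X m == X m0.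
have polyE (pi : {poly K}) g : G g ->
    \sum_(m <- r) c m * pi.[X m] * character (expo m) g = 0.
  move=> Gg.
  under eq_bigr do rewrite horner_coef mulr_sumr mulr_suml.
  rewrite exchange_big /= big1 // => k' _.
  rewrite (eq_bigr (fun m => pi`_k' * (c m * character (expo m) (h1 ^+ k' * g)%g))) => [|m _].
    by rewrite -mulr_sumr h ?mulr0 //; apply: GM => //; exact: GX.
  by rewrite characterM characterX /X; ring.
pose pi : {poly K} := \prod_(m <- r | ~~ Q m) ('X - (X m)%:P).
have pi0 m : m \in r -> ~~ Q m -> pi.[X m] = 0.
  move=> mr Qm; rewrite horner_prod; apply/eqP; rewrite prodf_seq_eq0.
  by apply/hasP; exists m; rewrite // Qm !hornerE subrr eqxx.
have pi1 : pi.[X m0] != 0.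
  rewrite horner_prod prodf_seq_neq0; apply/allP => m _; apply/implyP => Qm.
  by rewrite !hornerE subr_eq0 eq_sym.
have h_1 g : G g -> \sum_(m <- r | Q m) c m * character (expo m) g = 0.
  move=> /(polyE pi); rewrite (bigID Q) /= [X in _ + X]big_seq_cond.
  rewrite [X in _ + X]big1 ?addr0 => [|m /andP[mr Qm]]; last by rewrite pi0 // mulr0 mul0r.
  rewrite (eq_bigr (fun m => pi.[X m0] * (c m * character (expo m) g))) => [|m /eqP ->].
    by rewrite -mulr_sumr => /eqP; rewrite mulf_eq0 (negbTE pi1) => /eqP.
  by ring.
have h_2 g : G g -> \sum_(m <- r | ~~ Q m) c m * character (expo m) g = 0.
  by move=> Gg; have := h g Gg; rewrite (bigID Q) /= h_1 // add0r.
have sum1 : \sum_(m <- [seq m <- r | Q m]) c m * character (expo m) t = 0.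
  apply: IH => [|g Gg]; last by rewrite big_filter h_1.
  apply: leq_trans rk; rewrite size_filter -(count_predC Q r) -addn1 leq_add2l.
  by rewrite -has_count; apply/hasP; exists m1.
have sum2 : \sum_(m <- [seq m <- r | ~~ Q m]) c m * character (expo m) t = 0.
  apply: IH => [|g Gg]; last by rewrite big_filter h_2.
  apply: leq_trans rk; rewrite size_filter -(count_predC Q r) -addn1 addnC leq_add2r.
  by rewrite -has_count; apply/hasP; exists m0; rewrite ?mem_head //= /Q eqxx.
by rewrite (bigID Q) /= -[X in X + _]big_filter -[X in _ + X]big_filter sum1 sum2 addr0.
Qed.

Lemma closed_subgroup_characters t : zariski_closed G ->
  (forall z, trivial_on G z -> character z t = 1) -> G t.
Proof.
move=> [I GE] tG; rewrite GE => p Ip; rewrite meval_character.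
apply: relation_on_characters => // g Gg.
by rewrite -meval_character; move: Gg; rewrite GE; exact.
Qed.

End Subgroup.
End Characters.

(** * Monomials restricted to a subgroup *)
Section TrivialCharacters.
Local Open Scope ring_scope.
Context {R : realType} {n : nat}.
Implicit Types (G : set (torus R n)).

Lemma trivial_on0 G : trivial_on G (fun=> 0).
Proof. by move=> g _; rewrite character0. Qed.

Lemma eq_trivial_on G z w : z =1 w -> trivial_on G z -> trivial_on G w.
Proof. by move=> /funext ->. Qed.

Lemma trivial_onM G (e : int) z : trivial_on G z -> trivial_on G (fun i => e * z i).
Proof.
move=> hz g /hz zg; rewrite -(exp1rz _ e) -zg /character.
elim/big_rec2: _ => [|i y x _ ->]; first by rewrite exp1rz.
by rewrite expfzMl exprz_exp [z i * e]mulrC.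
Qed.

Lemma trivial_on_sum G (J : eqType) (r : seq J) (z : J -> 'I_n -> int) :
  (forall j, j \in r -> trivial_on G (z j)) -> trivial_on G (fun i => \sum_(j <- r) z j i).
Proof.
elim: r => [|j r IH] h.
  apply: (@eq_trivial_on G (fun=> 0)) => [i|]; last exact: trivial_on0.
  by rewrite big_nil.
apply: (@eq_trivial_on G (fun i => z j i - (- 1 * \sum_(j <- r) z j i))).
  by move=> i; rewrite big_cons mulN1r opprK.
apply: trivial_onB; first by apply: h; rewrite mem_head.
by apply/trivial_onM/IH => j' jr; apply: h; rewrite inE jr orbT.
Qed.

End TrivialCharacters.

Lemma leq_expn a b e : (a <= b -> a ^ e <= b ^ e)%N.
Proof. by move=> ab; elim: e => // e IH; rewrite !expnS leq_mul. Qed.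

Section FewCharacters.
Local Open Scope ring_scope.
Context {R : realType} {n : nat}.
Variables (G : set (torus R n)) (V : {set 'I_n}).
Hypothesis Gclosed : zariski_closed G.
Hypothesis G1 : G 1%g.
Hypothesis GM : forall s t, G s -> G t -> G (s * t)%g.
Hypothesis GV : forall g, G g -> (forall i, i \notin V -> g i = 1) -> g = 1%g.

Lemma two_expz_eq1 (K : numFieldType) (e : int) : (2%:R : K) ^ e = 1 -> e = 0.
Proof.
have two k : (2%:R : K) ^+ k = 1 -> k = 0%N.
  by move/eqP; rewrite -natrX pnatr_eq1 -[1%N](expn0 2) eqn_exp2l // => /eqP.
case: e => k; first by move=> /two ->.
by rewrite NegzE -invr_expz => /eqP; rewrite invr_eq1 => /eqP/two.
Qed.

(** An integer vector [w] supported in [V] and orthogonal to all characters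
    trivial on [G] gives the element [2 ^ w] of [G] in the coordinate torus of
    [V]. *)
Lemma one_parameter_perp (w : 'I_n -> int) : (forall i, i \notin V -> w i = 0) ->
  (forall z, trivial_on G z -> \sum_i z i * w i = 0) -> forall i, w i = 0.
Proof.
move=> wV perp.
have two0 i : [ffun i => 2%:R ^ w i] i != 0 :> R[i] by rewrite ffunE expfz_neq0 ?pnatr_eq0.
have two0' : [forall i, [ffun i => 2%:R ^ w i] i != 0 :> R[i]] by apply/forallP.
pose t : torus R n := Torus two0'.
have tE i : t i = 2%:R ^ w i by rewrite ffunE.
have Gt : G t.
  apply: closed_subgroup_characters => // z /perp zw.
  rewrite /character (eq_bigr (fun i => 2%:R ^ (z i * w i))) => [|i _]; last first.
    by rewrite tE mulrC exprz_exp.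
  have -> (r : seq 'I_n) : \prod_(i <- r) (2%:R : R[i]) ^ (z i * w i) = 2%:R ^ (\sum_(i <- r) z i * w i).
    by elim/big_rec2: _ => // i y x _ ->; rewrite expfzDr // pnatr_eq0.
  by rewrite zw.
move=> i; apply: (@two_expz_eq1 R[i]); rewrite -tE.
by rewrite (GV Gt) => [|j /wV jV]; rewrite ?torus1E // tE jV.
Qed.

Lemma power_relations : exists2 D : nat, (0 < D)%N &
  forall i, i \in V -> exists2 z, trivial_on G z &
    forall j, j \in V -> z j = if j == i then Posz D else 0.
Proof.
pose S (y : 'I_#|V| -> int) := exists2 z, trivial_on G z & forall k, z (enum_val k) = y k.
have [||w perp k|D D0 h] := @full_rank_of_perp _ S.
- by exists (fun=> 0); first exact: trivial_on0.
- move=> y1 y2 [z1 h1 e1] [z2 h2 e2]; exists (fun i => z1 i - z2 i).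
    exact: trivial_onB.
  by move=> k; rewrite e1 e2.
- pose w' i := \sum_(k < #|V|) (enum_val k == i)%:R * w k.
  have w'E k' : w' (enum_val k') = w k'.
    rewrite /w' (bigD1 k') //= eqxx mul1r big1 ?addr0 // => k'' ne.
    by rewrite (inj_eq enum_val_inj) (negbTE ne) mul0r.
  rewrite -w'E; apply: one_parameter_perp => [i iV|z Gz].
    rewrite /w' big1 // => k' _; case: eqP => [ki|]; last by rewrite mul0r.
    by rewrite -ki enum_valP in iV.
  have e0 : \sum_k z (enum_val k) * w k = 0 by apply: perp; exists z.
  rewrite -[RHS]e0.
  rewrite (bigID (mem V)) /= [X in _ + X]big1 ?addr0 => [|i iV].
    rewrite big_enum_val /=; apply: eq_bigr => k' _; by rewrite w'E.
  rewrite /w' big1 ?mulr0 // => k' _; case: eqP => [ki|]; last by rewrite mul0r.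
  by rewrite -ki enum_valP in iV.
exists D => // i iV; have [z Gz zE] := h (enum_rank_in iV i); exists z => // j jV.
have := zE (enum_rank_in iV j); rewrite !enum_rankK_in // => ->.
by rewrite (can_in_eq (enum_rankK_in iV)).
Qed.

Definition exponents_le (B : nat) (m : 'X_{1..n}) := forall i, (m i <= B)%N.

(** On [G] the [D]-th power of a coordinate in [V] is a Laurent monomial in the
    coordinates off [V]. After reduction by these relations, a monomial is
    determined on [G] by its exponents in [V] modulo [D] and by its new exponents
    off [V], which stay within a multiple of [B]. *)
Lemma few_characters : exists C : nat, forall B : nat, (0 < B)%N ->
  exists (J : finType) (cls : 'X_{1..n} -> J),
    (#|J| <= C * B ^ (n - #|V|))%N /\
    forall m m', exponents_le B m -> exponents_le B m' -> cls m = cls m' ->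
      forall g, G g -> character (expo m) g = character (expo m') g.
Proof.
have [D D0 h] := power_relations.
have /choice[z zP] : forall i : 'I_n, exists z, i \in V -> trivial_on G z /\
    forall j, j \in V -> z j = if j == i then Posz D else 0.
  move=> i; have [iV|iV] := boolP (i \in V); last by exists (fun=> 0).
  by have [z hz zE] := h i iV; exists z.
(* Reducing an exponent bounded by B changes each other exponent by at most B Z. *)
pose Z := (\sum_(i in V) \sum_j `|z i j|)%N.
pose W B := (B * Z.+1).*2.
pose J B : finType := ({ffun {i | i \in V} -> 'I_D.-1.+1} *
   {ffun {i | i \notin V} -> 'I_(W B).+1})%type.
pose red (m : 'X_{1..n}) j : int := Posz (m j) - \sum_(i in V) Posz (m i %/ D) * z i j.
(* The shift by B (Z + 1) makes the reduced exponents nonnegative. *)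
pose cls B (m : 'X_{1..n}) : J B := ([ffun i => inord (m (val i) %% D)],
  [ffun j => inord `|red m (val j) + Posz (B * Z.+1)|]).
exists (D ^ #|V| * (Z.+1.*2.+1) ^ (n - #|V|))%N => B B0.
exists (J B), (cls B); split.
  have cV : #|{: {i | i \notin V}}| = (n - #|V|)%N.
    have := cardC V; rewrite card_ord card_sig => nE; rewrite -[RHS]/(n - #|V|)%N.
    have -> : #|[pred i | i \notin V]| = #|[predC V]| by apply: eq_card.
    by apply/eqP; rewrite -(eqn_add2l #|V|) nE subnKC // -[leqRHS]nE leq_addr.
  rewrite card_prod !card_ffun !card_ord card_sig prednK // cV.
  rewrite -mulnA leq_mul // -expnMn leq_expn // /W -!muln2.
  by rewrite mulSn (mulnAC Z.+1) [(Z.+1 * B)%N]mulnC -add1n leq_add2r.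
have red_le m j : exponents_le B m -> `|red m j| <= Posz (B * Z.+1).
  move=> mB; rewrite mulnS PoszD (le_trans (ler_normB _ _)) //.
  apply: lerD; first by have := mB j; lia.
  rewrite (le_trans (ler_norm_sum _ _ _)) //.
  have hZ : (\sum_(i in V) B * `|z i j| <= B * Z)%N.
    rewrite -big_distrr leq_mul2l /Z; apply/orP; right.
    by apply: leq_sum => i _; rewrite (bigD1 j) //= leq_addr.
  apply: (@le_trans _ _ (\sum_(i in V) Posz (B * `|z i j|))); last first.
    by rewrite -(big_morph Posz PoszD (erefl (Posz 0))) lez_nat.
  apply: ler_sum => i _; rewrite normrM PoszM abszE ler_wpM2r //.
  by rewrite lez_nat (leq_trans (leq_div _ _)).
move=> m m' mB m'B [e1 e2]; apply/trivial_onP.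
pose comb (i j : 'I_n) := (Posz (m i %/ D) - Posz (m' i %/ D)) * z i j.
apply: (@eq_trivial_on _ _ G (fun j => \sum_(i <- enum V) comb i j)) => [j|]; last first.
  apply: trivial_on_sum => i; rewrite mem_enum => iV.
  by apply: trivial_onM; have [] := zP i iV.
rewrite /comb big_enum /=; symmetry.
have [jV|jV] := boolP (j \in V).
  rewrite (bigD1 j) //= big1 ?addr0 => [|i /andP[iV ij]]; last first.
    by have [_ /(_ j jV) ->] := zP i iV; rewrite eq_sym (negbTE ij) mulr0.
  have [_ /(_ j jV) ->] := zP j jV; rewrite eqxx.
  move/ffunP: e1 => /(_ (exist _ j jV)); rewrite !ffunE /= => /(congr1 val) /=.
  rewrite !inordK ?prednK ?ltn_pmod // /expo => e.
  by rewrite {1}(divn_eq (m j) D) {1}(divn_eq (m' j) D) e !PoszD !PoszM; ring.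
move/ffunP: e2 => /(_ (exist _ j jV)); rewrite !ffunE /= => /(congr1 val) /=.
have bnd m1 : exponents_le B m1 -> 0 <= red m1 j + Posz (B * Z.+1) /\
    (absz (red m1 j + Posz (B * Z.+1))%R < (W B).+1)%N.
  by move=> m1B; have := red_le m1 j m1B; rewrite /W; move: (red m1 j); lia.
have [r1 r2] := bnd _ mB; have [r1' r2'] := bnd _ m'B.
rewrite !inordK // => e.
have : red m j = red m' j.
  by move: r1 r1' e; move: (red m j) (red m' j); lia.
rewrite /red /expo.
have -> : \sum_(i in V) (Posz (m i %/ D) - Posz (m' i %/ D)) * z i j =
    \sum_(i in V) Posz (m i %/ D) * z i j - \sum_(i in V) Posz (m' i %/ D) * z i j.
  by rewrite -sumrB; apply: eq_bigr => i _; rewrite mulrBl.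
move: (\sum_(i in V) _) (\sum_(i in V) _) => S S'; lia.
Qed.

End FewCharacters.

(** * Algebraic independence along chains of irreducible closed sets *)
Section Independence.
Local Open Scope ring_scope.
Context {R : realType} {n : nat}.
Local Notation K := R[i].
Implicit Types (t : torus R n) (Y Z : set (torus R n)) (p q : {mpoly K[n]}) (fs : seq {mpoly K[n]}).

(** Exponent vectors of length [l] with entries below [N], as nested pairs so that
    independence can be treated by recursion on the list of polynomials. *)
Fixpoint box (N l : nat) : finType :=
  if l is l'.+1 then ('I_N * box N l')%type else unit.

Lemma card_box N l : #|box N l| = (N ^ l)%N.
Proof. by elim: l => [|l IH] /=; rewrite ?card_unit // card_prod card_ord IH expnS. Qed.

Fixpoint box_monomial (N : nat) fs : box N (size fs) -> {mpoly K[n]} :=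
  match fs with
  | [::] => fun=> 1
  | f :: fs' => fun x => f ^+ x.1 * box_monomial x.2
  end.

Definition alg_independent Z fs := forall N (c : box N (size fs) -> K),
  (forall t, Z t -> \sum_x c x * (box_monomial x).@[t] = 0) -> forall x, c x = 0.

Lemma alg_independentS Y Z fs : (Y `<=` Z)%classic ->
  alg_independent Y fs -> alg_independent Z fs.
Proof. by move=> YZ hY N c h; apply: hY => t /YZ; exact: h. Qed.

Lemma zariski_closed_zero Z p : zariski_closed Z ->
  zariski_closed [set t | Z t /\ p.@[t] = 0]%classic.
Proof.
move=> [I ->]; exists (I `|` [set p])%classic; apply/seteqP; split=> t /=.
  by move=> [h tp] q [/h|->].
by move=> h; split=> [q Iq|]; apply: h; [left|right].
Qed.

(** Otherwise the zero sets of [p] and [q] would split [Z]. *)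
Lemma irreducible_mul Z p q : irreducible_closed Z ->
  (forall t, Z t -> (p * q).@[t] = 0) ->
  (forall t, Z t -> p.@[t] = 0) \/ (forall t, Z t -> q.@[t] = 0).
Proof.
move=> [Zc _ Zirr] pq.
have [|ZE|ZE] := Zirr _ _ (zariski_closed_zero p Zc) (zariski_closed_zero q Zc).
- apply/seteqP; split=> [t Zt|t [[]|[]]] //.
  by have /eqP := pq t Zt; rewrite mevalM mulf_eq0 => /orP[] /eqP; [left|right].
- by left => t; rewrite ZE => -[].
by right => t; rewrite ZE => -[].
Qed.

Lemma irreducible_expr Z p q k : irreducible_closed Z ->
  (exists2 t, Z t & p.@[t] != 0) -> (forall t, Z t -> (p ^+ k * q).@[t] = 0) ->
  forall t, Z t -> q.@[t] = 0.
Proof.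
move=> Zirr [t0 Zt0 pt0]; elim: k => [|k IH]; first by rewrite expr0 mul1r.
rewrite exprS -mulrA => /(irreducible_mul Zirr)[h|]; last exact: IH.
by rewrite h ?eqxx in pt0.
Qed.

(** In a relation for [p :: fs] on [Z], divide by the lowest power [p ^+ e] that
    occurs, which is allowed as [Z] is irreducible and [p] is nonzero on it. On
    [Y] only the terms with exponent [e] survive, and they form a relation between
    the [fs]. *)
Lemma alg_independent_cons Y Z p fs : irreducible_closed Z -> (Y `<=` Z)%classic ->
  (forall t, Y t -> p.@[t] = 0) -> (exists2 t, Z t & p.@[t] != 0) ->
  alg_independent Y fs -> alg_independent Z (p :: fs).
Proof.
move=> Zirr YZ pY pZ ind N c h.
suff H e (i : 'I_N) (y : box N (size fs)) : (i < e)%N -> c (i, y) = 0 by case=> i y; exact: (H i.+1).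
elim: e i y => // e IH i y; rewrite ltnS leq_eqVlt => /orP[/eqP ie|]; last exact: IH.
pose q := \sum_(x : box N (size (p :: fs))) if (e <= x.1)%N then
   c x *: (p ^+ (x.1 - e) * box_monomial x.2) else 0.
have q0 t : Z t -> q.@[t] = 0.
  apply: (irreducible_expr (k := e) Zirr pZ) => {}t /h; rewrite mevalM => <-.
  rewrite raddf_sum /= mulr_sumr; apply: eq_bigr => -[i' y'] _ /=.
  case: leqP => ei; last by rewrite meval0 mulr0 IH ?mul0r.
  by rewrite mevalZ mulrCA -mevalM mulrA -exprD subnKC.
apply: (ind N (fun y => c (i, y))) => t Yt.
rewrite -[RHS](q0 t (YZ t Yt)) raddf_sum /=.
pose term (j : 'I_N) (y : box N (size fs)) := (if (e <= j)%N then
   c (j, y) *: (p ^+ (j - e) * box_monomial y) else 0).@[t].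
rewrite (eq_bigr (fun x : 'I_N * box N (size fs) => term x.1 x.2)) => [|[] //].
rewrite -(pair_bigA _ term) /term /=.
rewrite (bigD1 i) //= [X in _ + X]big1 ?addr0 => [|i' ii'].
  apply: eq_bigr => y' _; rewrite -ie leqnn subnn expr0 mul1r mevalZ //.
apply: big1 => y' _; case: leqP => ei; last by rewrite meval0.
have : (e < i')%N by rewrite ltn_neqAle ei -ie eq_sym andbT (inj_eq val_inj).
by rewrite mevalZ mevalM -subn_gt0; case: (i' - e)%N => // k _; rewrite exprS !mevalM pY // !mul0r mulr0.
Qed.

Lemma chain_alg_independent Z l : irreducible_chain Z l ->
  exists2 fs, size fs = l & alg_independent Z fs.
Proof.
move=> [Y [YP Ylt]].
suff H k : (k <= l)%N -> exists2 fs, size fs = k & alg_independent (Y k) fs.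
  have [fs sz ind] := H l (leqnn l); exists fs => //; apply: alg_independentS ind.
  by case: (YP l (leqnn l)).
elim: k => [_|k IH kl].
  exists [::] => // N c h x; have [[_ [t Yt] _] _] := YP 0%N (leq0n l).
  by have := h t Yt; rewrite (bigD1 x) //= big1 ?addr0 ?meval1 ?mulr1 // => y; case: x y => -[].
have [fs sz ind] := IH (ltnW kl).
have [Yk_irr _] := YP k (ltnW kl); have [Yk1_irr _] := YP _ kl.
have [sub nsub] := Ylt k kl; have [[I IE] _ _] := Yk_irr.
have [t [Yt nYt]] : exists t, Y k.+1 t /\ ~ Y k t.
  by apply: contrapT => h; apply: nsub => t Yt; apply: contrapT => nt; apply: h; exists t.
have [p [Ip pt]] : exists p, I p /\ p.@[t] != 0.
  apply: contrapT => h; apply: nYt; rewrite IE => p Ip; apply: contrapT => /eqP pt.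
  by apply: h; exists p.
exists (p :: fs); first by rewrite /= sz.
apply: alg_independent_cons ind => //; last by exists t.
by move=> u; rewrite IE => /(_ p Ip).
Qed.

Definition degree_le B p := forall m, m \in msupp p -> (mdeg m <= B)%N.

Lemma degree_leM B C p q : degree_le B p -> degree_le C q -> degree_le (B + C) (p * q).
Proof.
move=> hp hq m /msuppM_le/allpairsP[[m1 m2] /= [/hp h1 /hq h2 ->]].
by rewrite mdegD leq_add.
Qed.

Lemma degree_leX B p k : degree_le B p -> degree_le (k * B) (p ^+ k).
Proof.
move=> hp; elim: k => [|k IH]; last by rewrite exprS mulSn; apply: degree_leM.
by move=> m; rewrite expr0 msupp1 inE => /eqP->; rewrite mdeg0.
Qed.

Lemma degree_le_box D N fs : (forall f, f \in fs -> degree_le D f) ->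
  forall x : box N (size fs), degree_le (size fs * (N * D)) (box_monomial x).
Proof.
elim: fs => [|f fs IH] hD x /=.
  by move=> m; rewrite msupp1 inE => /eqP->; rewrite mdeg0.
rewrite mulSn; apply: degree_leM; last by apply: IH => g gfs; apply: hD; rewrite inE gfs orbT.
move=> m mf; apply: leq_trans (degree_leX _ mf) _; first by apply: hD; rewrite mem_head.
by rewrite leq_mul2r ltnW ?orbT.
Qed.

(** The [N ^ size fs] products of powers of the [fs] have degree at most a constant
    times [N], so on [G] they are combinations of [O(N ^ k)] functions; for large
    [N] a linear relation is forced when [k < size fs]. *)
Lemma alg_independent_size G (k : nat) fs :
  (exists C : nat, forall B : nat, (0 < B)%N ->
  exists (J : finType) (cls : 'X_{1..n} -> J),
    (#|J| <= C * B ^ k)%N /\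
    forall m m', exponents_le B m -> exponents_le B m' -> cls m = cls m' ->
      forall g, G g -> character (expo m) g = character (expo m') g) ->
  alg_independent G fs -> (size fs <= k)%N.
Proof.
move=> [C few] ind; rewrite leqNgt; apply/negP => ksz.
have [D hD] : exists D, forall f, f \in fs -> degree_le D f.
  elim: fs {ind ksz} => [|f fs [D hD]]; first by exists 0%N.
  exists (maxn (msize f) D) => g; rewrite inE => /predU1P[->|/hD h] m mg.
    by rewrite leq_max ltnW // msize_mdeg_lt.
  by rewrite leq_max h ?orbT.
(* N exceeds C D' ^ k, so that C (D' N) ^ k < N ^ k.+1. *)
pose D' := (size fs * D).+1; pose N := (C * D' ^ k).+1.
have [|J [cls [cardJ clsP]]] := few (D' * N)%N; first by rewrite muln_gt0.
have mon_le (x : box N (size fs)) m : m \in msupp (box_monomial x) -> exponents_le (D' * N) m.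
  move=> /(degree_le_box hD) h i; apply: leq_trans (leq_trans h _).
    by rewrite mdegE (bigD1 i) //= leq_addr.
  by rewrite mulnCA mulnC leq_mul2r leqnSn orbT.
have /choice[rep repP] : forall j, exists m, forall m', exponents_le (D' * N) m' ->
    cls m' = j -> forall g, G g -> character (expo m') g = character (expo m) g.
  move=> j; have [[m [hm <-]]|h] := pselect (exists m, exponents_le (D' * N) m /\ cls m = j).
    by exists m => m' hm' e; exact: clsP.
  by exists 0%MM => m' hm' e; case: h; exists m'.
have lt_card : (#|J| < #|box N (size fs)|)%N.
  apply: leq_ltn_trans cardJ _; rewrite card_box expnMn mulnA.
  apply: (@leq_trans (N ^ k.+1)); last by rewrite leq_pexp2l.
  by rewrite expnS ltn_mul2r expn_gt0 /= ltnSn.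
pose A := \matrix_(x < #|box N (size fs)|, j < #|J|)
  \sum_(m <- msupp (box_monomial (enum_val x)) | enum_rank (cls m) == j)
     (box_monomial (enum_val x))@_m.
have : kermx A != 0.
  rewrite -mxrank_eq0 mxrank_ker subn_eq0 -ltnNge.
  by apply: leq_ltn_trans (rank_leq_col A) lt_card.
case/rowV0Pn => v /sub_kermxP vA /negP; apply; apply/eqP/rowP => x; rewrite mxE.
have := ind N (fun x => v 0 (enum_rank x)) _ (enum_val x); rewrite enum_valK; apply.
move=> t Gt; pose psi (j : 'I_#|J|) := character (expo (rep (enum_val j))) t.
have monE (y : 'I_#|box N (size fs)|) : (box_monomial (enum_val y)).@[t] = \sum_j A y j * psi j.
  rewrite meval_character (partition_big (fun m => enum_rank (cls m)) predT) //=.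
  apply: eq_bigr => j _; rewrite mxE mulr_suml big_seq_cond [RHS]big_seq_cond.
  apply: eq_bigr => m /andP[mm /eqP mj]; congr (_ * _).
  by apply: repP => //; [exact: mon_le mm|rewrite -mj enum_rankK].
rewrite (reindex_onto enum_val enum_rank) => [|y _]; last exact: enum_rankK.
rewrite (eq_bigl predT) => [|y]; last by rewrite enum_valK eqxx.
transitivity (\sum_j (v *m A) 0 j * psi j); last first.
  by rewrite big1 // => j _; rewrite vA mxE mul0r.
under [RHS]eq_bigr do rewrite mxE mulr_suml.
rewrite exchange_big /=; apply: eq_bigr => y _.
rewrite enum_valK monE mulr_sumr; apply: eq_bigr => j _; by rewrite mulrA.
Qed.

End Independence.

Section UpperBound.
Context {R : realType} {n : nat}.

Lemma subgroup_chain_le (G : set (torus R n)) (V : {set 'I_n}) l :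
  algebraic_subgroup G -> (forall g, G g -> (forall i, i \notin V -> g i = 1%R) -> g = 1%g) ->
  irreducible_chain G l -> (l <= n - #|V|)%N.
Proof.
move=> [Gc Ggrp] GV /chain_alg_independent[fs <- ind].
have G1 : G 1%g by case: Ggrp => /set_mem.
have GM s t : G s -> G t -> G (s * t)%g.
  move=> Gs Gt; apply/set_mem/(group_closedM Ggrp); exact: mem_set.
exact: alg_independent_size (few_characters Gc G1 GM GV) ind.
Qed.

End UpperBound.

(** * The torus of a colouring *)
Section ColorTorus.
Local Open Scope ring_scope.
Context {R : realType} {n d : nat}.
Local Notation K := R[i].
Variables (col : 'I_n -> 'I_d) (rho : 'I_d -> 'I_n).
Hypothesis rhoK : cancel rho col.

Definition color_torus : set (torus R n) :=
  [set t | forall c, \prod_(i | col i == c) t i = 1]%classic.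

(** With one representative [rho c] chosen in each colour, the other coordinates
    parametrize the torus freely. *)
Definition free_index : {set 'I_n} := [set i | rho (col i) != i]%SET.

Lemma card_free_index : #|free_index| = (n - d)%N.
Proof.
have -> : free_index = ~: (rho @: [set: 'I_d]%SET).
  apply/finset.setP => i; rewrite !inE; congr (~~ _).
  apply/eqP/imsetP => [e|[c _ ->]]; last by rewrite rhoK.
  by exists (col i).
by rewrite cardsCs finset.setCK card_imset ?cardsT ?card_ord //; exact: can_inj rhoK.
Qed.

Lemma color_class_prod (u : 'I_n -> K) c :
  \prod_(i | col i == c) u i =
    u (rho c) * \prod_(i in free_index | col i == c) u i.
Proof.
rewrite (bigD1 (rho c)) /= ?rhoK //; congr (_ * _); apply: eq_bigl => i.
rewrite inE andbC; have [->|] := eqVneq (col i) c; rewrite ?andbT ?andbF //.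
by rewrite eq_sym.
Qed.

(** The members of the chain: the free coordinates outside [S] are set to [1]. *)
Definition subtorus (S : {set 'I_n}) : set (torus R n) :=
  [set t | color_torus t /\ forall i, i \in free_index -> i \notin S -> t i = 1]%classic.

Lemma subtorus_closed S : zariski_closed (subtorus S).
Proof.
exists [set p | (exists c, p = \prod_(i | col i == c) 'X_i - 1) \/
  exists i, [/\ i \in free_index, i \notin S & p = 'X_i - 1]]%classic.
apply/seteqP; split=> t /=.
  move=> [tG tS] p [[c ->]|[i [iT iS ->]]].
    rewrite mevalB meval1 rmorph_prod /=.
    by under eq_bigr do rewrite mevalXU; rewrite tG subrr.
  by rewrite mevalB meval1 mevalXU tS // subrr.
move=> h; split=> [c|i iT iS].
  have := h _ (or_introl (ex_intro _ c erefl)).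
  rewrite mevalB meval1 rmorph_prod /= => /eqP; rewrite subr_eq0.
  by under eq_bigr do rewrite mevalXU; move=> /eqP.
have := h ('X_i - 1) (or_intror (ex_intro _ i (And3 iT iS erefl))).
by rewrite mevalB meval1 mevalXU => /eqP; rewrite subr_eq0 => /eqP.
Qed.

Lemma subtorusT : subtorus [set: 'I_n]%SET = color_torus.
Proof.
by apply/seteqP; split=> t => [[]//|tG]; split=> // i _; rewrite finset.in_setT.
Qed.

Lemma color_torus_subgroup : algebraic_subgroup color_torus.
Proof.
split; first by rewrite -subtorusT; exact: subtorus_closed.
split; first by apply/mem_set => c; rewrite big1 // => i _; rewrite torus1E.
move=> s t /set_mem sG /set_mem tG; apply/mem_set => c.
under eq_bigr do rewrite torusME torusVE.
by rewrite big_split /= prodfV sG tG invr1 mulr1.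
Qed.

(** Rational functions in one variable whose denominator is a power of [D]. *)
Definition regular_off (D : {poly K}) (f : K -> K) :=
  exists N, exists p : {poly K}, forall x, D.[x] != 0 -> f x * D.[x] ^+ N = p.[x].

Lemma regular_offC D (c : K) : regular_off D (fun=> c).
Proof. by exists 0%N, c%:P => x _; rewrite hornerC mulr1. Qed.

Lemma regular_offM D f g : regular_off D f -> regular_off D g ->
  regular_off D (fun x => f x * g x).
Proof.
move=> [N [p hp]] [M [q hq]]; exists (N + M)%N, (p * q) => x Dx.
by rewrite hornerM -hp // -hq // exprD; ring.
Qed.

Lemma regular_offD D f g : regular_off D f -> regular_off D g ->
  regular_off D (fun x => f x + g x).
Proof.
move=> [N [p hp]] [M [q hq]]; exists (N + M)%N, (p * D ^+ M + q * D ^+ N) => x Dx.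
by rewrite hornerD !hornerM !horner_exp -hp // -hq // exprD; ring.
Qed.

Lemma regular_off_meval D (s : K -> 'I_n -> K) (p : {mpoly K[n]}) :
  (forall i, regular_off D (s^~ i)) -> regular_off D (fun x => p.@[s x]).
Proof.
move=> sD.
have prodP (r : seq 'I_n) (m : 'X_{1..n}) :
    regular_off D (fun x => \prod_(i <- r) s x i ^+ m i).
  elim: r => [|i r IH].
    under eq_fun do rewrite big_nil; exact: regular_offC.
  under eq_fun do rewrite big_cons; apply: regular_offM IH.
  elim: (m i) => [|k IH]; first by under eq_fun do rewrite expr0; exact: regular_offC.
  by under eq_fun do rewrite exprS; apply: regular_offM.
under eq_fun do rewrite mevalE.
elim: (msupp p) => [|m r IH]; first by under eq_fun do rewrite big_nil; exact: regular_offC.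
under eq_fun do rewrite big_cons; apply: regular_offD IH.
by apply: regular_offM; [exact: regular_offC|exact: prodP].
Qed.

Lemma poly_eq0_nat (p : {poly K}) : (forall k : nat, p.[k%:R] = 0) -> p = 0.
Proof.
move=> h; apply: contrapT => /eqP /exists_nonroot[k]; by rewrite h eqxx.
Qed.

(** Two points of a subtorus are joined by a rational curve inside it: the free
    coordinates are interpolated linearly, and the representatives of the colours
    follow as inverses of products. It is defined off the zeros of [line_den]. *)
Section Line.
Variables (S : {set 'I_n}) (y1 y2 : torus R n).
Hypothesis (Sy1 : subtorus S y1) (Sy2 : subtorus S y2).

Definition line_coord i : {poly K} := (y1 i)%:P + (y2 i - y1 i) *: 'X.
Definition line_den : {poly K} := \prod_(i in free_index) line_coord i.
Definition line x i : K := if i \in free_index then (line_coord i).[x]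
  else (\prod_(j in free_index | col j == col i) (line_coord j).[x])^-1.

Lemma line_coordE i x : (line_coord i).[x] = y1 i + (y2 i - y1 i) * x.
Proof. by rewrite !hornerE. Qed.

Lemma line_den_neq0 x i : line_den.[x] != 0 -> i \in free_index -> (line_coord i).[x] != 0.
Proof. by rewrite horner_prod => /prodf_neq0; exact. Qed.

Lemma line_regular i : regular_off line_den (line^~ i).
Proof.
have [iT|/negbTE iT] := boolP (i \in free_index).
  by exists 0%N, (line_coord i) => x _; rewrite /line iT mulr1.
exists 1%N, (\prod_(j in free_index | col j != col i) line_coord j) => x Dx.
rewrite /line iT expr1 !horner_prod [X in _ * X](bigID (fun j => col j == col i)) /= mulKf //.
by apply/prodf_neq0 => j /andP[jT _]; exact: line_den_neq0.
Qed.

Lemma color_torus_determined (t : torus R n) i : color_torus t -> i \notin free_index ->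
  t i = (\prod_(j in free_index | col j == col i) t j)^-1.
Proof.
move=> /(_ (col i)); rewrite color_class_prod inE negbK => tG /eqP iE.
rewrite iE in tG; apply: (mulIf (x := \prod_(j in free_index | col j == col i) t j)).
  by apply/prodf_neq0 => j _; exact: torus_neq0.
by rewrite tG mulVf //; apply/prodf_neq0 => j _; exact: torus_neq0.
Qed.

Lemma line0 i : line 0 i = y1 i.
Proof.
rewrite /line; case: ifP => iT; first by rewrite line_coordE mulr0 addr0.
rewrite (color_torus_determined (proj1 Sy1)) ?iT //; congr (_^-1).
by apply: eq_bigr => j _; rewrite line_coordE mulr0 addr0.
Qed.

Lemma line1 i : line 1 i = y2 i.
Proof.
rewrite /line; case: ifP => iT; first by rewrite line_coordE mulr1 subrKC.
rewrite (color_torus_determined (proj1 Sy2)) ?iT //; congr (_^-1).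
by apply: eq_bigr => j _; rewrite line_coordE mulr1 subrKC.
Qed.

Lemma line_subtorus x : line_den.[x] != 0 ->
  exists2 t, subtorus S t & forall i, t i = line x i.
Proof.
move=> Dx; have nz : [forall i, [ffun i => line x i] i != 0].
  apply/forallP => i; rewrite ffunE /line; case: ifP => [|_]; first exact: line_den_neq0.
  by rewrite invr_eq0; apply/prodf_neq0 => j /andP[jT _]; exact: line_den_neq0.
pose t : torus R n := Torus nz.
have tE i : t i = line x i by rewrite ffunE.
exists t => //; split=> [c|i iT iS]; last first.
  by rewrite tE /line iT line_coordE (proj2 Sy1) // (proj2 Sy2) // subrr mul0r addr0.
rewrite color_class_prod tE /line inE rhoK eqxx /=.
rewrite [X in _ * X](eq_bigr (fun j => (line_coord j).[x])) => [|j /andP[jT _]].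
  by rewrite mulVf //; apply/prodf_neq0 => j /andP[jT _]; exact: line_den_neq0.
by rewrite tE /line jT.
Qed.

End Line.

(** If [p] vanishes on [A] but not at [y1], and [q] vanishes on [B] but not at
    [y2], then on the curve through [y1] and [y2] the product [p q] vanishes
    wherever the curve is defined, although neither factor vanishes identically. *)
Lemma subtorus_irreducible S : irreducible_closed (subtorus S).
Proof.
split; first exact: subtorus_closed.
  by exists 1%g; split=> [c|i _ _]; rewrite ?torus1E // big1 // => i _; rewrite torus1E.
move=> A B [IA AE] [IB BE] SAB.
have [|nA] := pselect (subtorus S `<=` A)%classic.
  by left; apply/seteqP; split=> // t At; rewrite SAB; left.
right; apply/seteqP; split=> [y2 Sy2|t Bt]; last by rewrite SAB; right.
apply: contrapT => nB.
have [y1 [Sy1 nAy1]] : exists y1, subtorus S y1 /\ ~ A y1.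
  by apply: contrapT => h; apply: nA => t St; apply: contrapT => nt; apply: h; exists t.
have witness (I : set {mpoly K[n]}) (y : torus R n) : ~ (forall p, I p -> p.@[y] = 0) ->
    exists2 p, I p & p.@[y] != 0.
  move=> h; apply: contrapT => h'; apply: h => p Ip; apply: contrapT => /eqP py.
  by apply: h'; exists p.
have [|p Ip py1] := witness IA y1; first by rewrite AE in nAy1.
have [|q Iq qy2] := witness IB y2; first by rewrite BE in nB.
pose D := line_den y1 y2; pose s := line y1 y2.
have reg i : regular_off D (s^~ i) by exact: line_regular.
have [N [p' pE]] := regular_off_meval p reg.
have [M [q' qE]] := regular_off_meval q reg.
have ev0 r : r.@[s 0] = r.@[y1] by apply: meval_eq => i; exact: (line0 _ Sy1).
have ev1 r : r.@[s 1] = r.@[y2] by apply: meval_eq => i; exact: (line1 _ Sy2).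
have D0 : D.[0] != 0.
  rewrite horner_prod; apply/prodf_neq0 => i _.
  by rewrite line_coordE mulr0 addr0 torus_neq0.
have D1 : D.[1] != 0.
  rewrite horner_prod; apply/prodf_neq0 => i _.
  by rewrite line_coordE mulr1 subrKC torus_neq0.
have /eqP : D * (p' * q') = 0.
  apply: poly_eq0_nat => k; rewrite !hornerM.
  have [->|Dk] := eqVneq D.[k%:R] 0; first by rewrite mul0r.
  have [t St tE] := line_subtorus Sy1 Sy2 Dk.
  rewrite -pE // -qE // -(meval_eq p tE) -(meval_eq q tE).
  move: St; rewrite SAB => -[]; rewrite ?AE ?BE /= => ht.
    by rewrite (ht p Ip) !(mul0r, mulr0).
  by rewrite (ht q Iq) !(mul0r, mulr0).
rewrite !mulf_eq0 => /or3P[] /eqP e.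
- by rewrite e horner0 eqxx in D0.
- have := pE _ D0; rewrite e horner0 ev0 => /eqP.
  by rewrite mulf_eq0 expf_eq0 (negbTE D0) (negbTE py1) andbF.
have := qE _ D1; rewrite e horner0 ev1 => /eqP.
by rewrite mulf_eq0 expf_eq0 (negbTE D1) (negbTE qy2) andbF.
Qed.

(** The free coordinates are released one at a time. *)
Lemma color_torus_chain : irreducible_chain color_torus (n - d).
Proof.
pose T := enum free_index.
have sT : size T = (n - d)%N by rewrite -cardE card_free_index.
pose S k : {set 'I_n} := [set i in take k T]%SET.
exists (fun k => subtorus (S k)); split=> [k _|k kd].
  by split; [exact: subtorus_irreducible|move=> t []].
have /card_gt0P[i0 _] : (0 < #|free_index|)%N.
  by rewrite card_free_index (leq_ltn_trans _ kd).
pose i := nth i0 T k.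
have iT : i \in free_index by rewrite -mem_enum mem_nth // sT.
have iS : i \notin S k.
  rewrite inE; apply/negP => /(nthP i0)[j]; rewrite size_take sT kd => jk.
  rewrite nth_take // => /eqP; rewrite nth_uniq ?enum_uniq ?sT // ?(ltn_trans jk) //.
  by move=> /eqP jk'; rewrite jk' ltnn in jk.
have SE : S k.+1 = i |: S k.
  by apply/finset.setP => j; rewrite !inE (take_nth i0) ?sT // mem_rcons inE.
split=> [t [tG tS]|]; first split=> // j jT.
  by rewrite SE !inE negb_or => /andP[_ jS]; apply: tS => //; rewrite inE.
pose r := rho (col i).
have ri : r != i by move: iT; rewrite inE.
(* Releasing i admits the point with 2 at i and 1/2 at its representative r. *)
have nz : [forall j, [ffun j => if j == i then 2%:R else if j == r then 2%:R^-1 else 1 : K] j != 0].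
  by apply/forallP => j; rewrite ffunE; case: ifP => _; [|case: ifP => _];
    rewrite ?oner_eq0 ?invr_eq0 ?pnatr_eq0.
pose t : torus R n := Torus nz.
have tE j : t j = if j == i then 2%:R else if j == r then 2%:R^-1 else 1 by rewrite ffunE.
move=> sub; have [|_ /(_ i iT iS)] := sub t; last by rewrite tE eqxx => /eqP; rewrite pnatr_eq1.
split=> [c|j jT jS].
  rewrite color_class_prod; have [ci|ci] := eqVneq (col i) c.
    rewrite (bigD1 i) ?iT ?ci ?eqxx //= big1 => [|j /andP[/andP[jT cj] ji]].
      by rewrite mulr1 !tE -ci (negbTE ri) !eqxx mulVf // pnatr_eq0.
    rewrite tE (negbTE ji); case: eqP => // jr; move: jT.
    by rewrite jr inE rhoK eqxx.
  rewrite big1 => [|j /andP[jT /eqP cj]].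
    rewrite mulr1 tE; case: eqP => [e|_]; first by rewrite -e rhoK eqxx in ci.
    by case: eqP => // /(can_inj rhoK) e; rewrite e eqxx in ci.
  rewrite tE; case: eqP => [e|_]; first by rewrite -cj e eqxx in ci.
  by case: eqP => // jr; move: jT; rewrite jr inE rhoK eqxx.
rewrite tE; case: eqP => [e|_]; first by move: jS; rewrite SE e !inE eqxx.
by case: eqP => // jr; move: jT; rewrite jr inE rhoK eqxx.
Qed.

End ColorTorus.

(** * Isotropy groups and the maximal dimension *)
Section Isotropy.
Local Open Scope quotient_scope.
Context {R : realType} {m n : nat}.
Variables (P : set 'rV[R]_m) (F : 'I_n -> set 'rV[R]_m).

Lemma zact_fixP (x : P) (g t : torus R n) :
  zact g (\pi_(ZP P F) (x, t)) = \pi_(ZP P F) (x, t) <->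
  forall i, ~ F i (val x) -> g i = 1%R.
Proof.
rewrite zact_pi; split=> [/eqmodP/zrelP[_ h] i Fi|h].
  have := h i Fi; rewrite /= torusME -[RHS]mul1r; exact/mulIf/torus_neq0.
by apply/eqmodP/zrelP; split=> //= i Fi; rewrite torusME h // mul1r.
Qed.

Lemma free_at_point (G : set (torus R n)) (x : 'rV[R]_m) : P x -> acts_freely P F G ->
  forall g, G g -> (forall i, i \notin inc F x -> g i = 1%R) -> g = 1%g.
Proof.
move=> Px free g Gg g1.
apply: (free g (\pi_(ZP P F) (SigSub (mem_set Px) : P, 1%g)) Gg).
by apply/zact_fixP => i Fi; apply: g1; apply/incP.
Qed.

Lemma color_torus_free d (col : 'I_n -> 'I_d) :
  (forall x i j, P x -> F i x -> F j x -> col i = col j -> i = j) ->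
  acts_freely P F (color_torus col).
Proof.
move=> colP g z gG; elim/quotW: z => -[x t] /zact_fixP g1.
apply: torusP => i; rewrite torus1E.
have [Fi|] := pselect (F i (val x)); last exact: g1.
have := gG (col i); rewrite (bigD1 i) //= big1 ?mulr1 // => j /andP[/eqP cji ji].
apply: g1 => Fj; case/eqP: ji; exact: (colP (val x) j i (set_mem (valP x)) Fj Fi cji).
Qed.

End Isotropy.

Theorem corollary4p6 (R : realType) (m n d : nat)
    (P : set 'rV[R]_m) (F : 'I_n -> set 'rV[R]_m) :
  (1 <= d)%N ->
  simple_polytope d P ->
  even_polytope P ->
  injective F ->
  (forall A : set 'rV[R]_m, facet P A <-> exists i, F i = A) ->
  s_number P F (n - d)%N.
Proof.
move=> d_gt0 simpleP evenP F_inj facetF.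
have [col colP] := simple_even_coloring d_gt0 simpleP F_inj facetF evenP.
have [v vv Pv] := simple_has_vertex simpleP.
have cardv := card_vertex_inc simpleP F_inj facetF vv.
have col_inj : {in inc F v &, injective col}.
  by move=> i j /incP Fi /incP Fj; exact: colP Fi Fj.
have /choice[rho rhoK] : forall c, exists i, col i = c.
  move=> c; suff : c \in col @: inc F v by case/imsetP => i _ ->; exists i.
  suff -> : col @: inc F v = [set: 'I_d]%SET by rewrite finset.in_setT.
  by apply/eqP; rewrite eqEcard finset.subsetT cardsT card_ord (card_in_imset col_inj) cardv /=.
have upper (G : set (torus R n)) l : algebraic_subgroup G -> acts_freely P F G ->
    irreducible_chain G l -> (l <= n - d)%N.
  move=> algG freeG; rewrite -cardv; apply: subgroup_chain_le algG _.
  exact: free_at_point freeG.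
have algG : algebraic_subgroup (color_torus col) := color_torus_subgroup col rho.
have freeG := color_torus_free colP.
split; last by move=> G l aG fG [chainG _]; exact: upper chainG.
exists (color_torus col); split=> //; split; first exact: color_torus_chain rhoK.
by move=> l; exact: upper.
Qed.
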